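(* Let $\alpha\in\mathbb{N}\cup\{0\}$. Assume that $h\in C_c^\infty((0,2))$ satisfies, for each $0<s<1$, $$\int_{0}^{1-s}\frac{t\,h(t)}{t^{2\alpha}}\Big\{\big[(1+t)^2-s^2\big]\big[(1-t)^2-s^2\big]\Big\}^{\alpha-\frac12}\,dt=\int_{1+s}^{2}\frac{t\,h(t)}{t^{2\alpha}}\Big\{\big[(1+t)^2-s^2\big]\big[(1-t)^2-s^2\big]\Big\}^{\alpha-\frac12}\,dt .$$ Then for any $\lambda>0$, $$y_\alpha(\lambda)\int_0^2 t\,h(t)\,j_\alpha(\lambda t)\,dt=j_\alpha(\lambda)\int_0^2 t\,h(t)\,y_\alpha(\lambda t)\,dt .$$
   Context: $J_\alpha$ and $Y_\alpha$ denote the standard Bessel functions of the first and second kind of order $\alpha$. The normalized Bessel functions of the first and second kind are $$j_\alpha(x)=2^\alpha\Gamma(\alpha+1)\frac{J_\alpha(x)}{x^\alpha},\qquad y_\alpha(x)=2^\alpha\Gamma(\alpha+1)\frac{Y_\alpha(x)}{x^\alpha},\qquad x>0.$$ *)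

(* Defs.v *)
From Stdlib Require Import Reals Factorial.
From Coquelicot Require Import Coquelicot.
Open Scope R_scope.

Definition harmonic (n : nat) : R := sum_n_m (fun k => / INR k) 1 n.

(** Euler-Mascheroni constant. *)
Definition euler_gamma : R := real (Lim_seq (fun n => harmonic n - ln (INR n))).

(** The digamma function at positive integers: [psi_S n] is psi(n + 1). *)
Definition psi_S (n : nat) : R := harmonic n - euler_gamma.

(** J_n(x) = sum_(k >= 0) (-1)^k / (k! (n+k)!) (x/2)^(2k+n). *)
Definition besselJ (n : nat) (x : R) : R :=
  Series (fun k => (-1) ^ k / (INR (fact k) * INR (fact (n + k)))
                   * (x / 2) ^ (2 * k + n)).

(** Y_n for integer order and x > 0 (Abramowitz-Stegun 9.1.11, DLMF 10.8.1):
    pi Y_n(x) = 2 ln(x/2) J_n(x)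
      - sum_(0 <= k < n) (n-k-1)!/k! (x/2)^(2k-n)
      - sum_(k >= 0) (psi(k+1) + psi(n+k+1)) (-1)^k / (k! (n+k)!) (x/2)^(2k+n).
    The finite sum is empty for n = 0; since [sum_f_R0 f m] has m + 1 terms,
    this case is separated. *)
Definition besselY_principal (n : nat) (x : R) : R :=
  match n with
  | O => 0
  | S m => sum_f_R0 (fun k => INR (fact (m - k)) / INR (fact k)
                              * ((x / 2) ^ (2 * k) / (x / 2) ^ n)) m
  end.

Definition besselY (n : nat) (x : R) : R :=
  / PI * (2 * ln (x / 2) * besselJ n x
          - besselY_principal n x
          - Series (fun k => (psi_S k + psi_S (n + k))
                             * ((-1) ^ k / (INR (fact k) * INR (fact (n + k)))
                                * (x / 2) ^ (2 * k + n)))).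

(** Normalized Bessel functions, for x > 0; Gamma(n + 1) = n!. *)
Definition nbesselJ (n : nat) (x : R) : R :=
  2 ^ n * INR (fact n) * (besselJ n x / x ^ n).

Definition nbesselY (n : nat) (x : R) : R :=
  2 ^ n * INR (fact n) * (besselY n x / x ^ n).

(** Real-valued C_c^infty((a, b)); functions are extended by 0 to all of R. *)
Definition Cc_infty (a b : R) (h : R -> R) : Prop :=
  (forall (n : nat) (x : R), ex_derive_n h n x) /\
  (exists c d : R, a < c /\ d < b /\ forall x : R, x < c \/ d < x -> h x = 0).

(** The base of [Rpower] is positive when 0 < t < 1 - s or 1 + s < t, for
    0 < s < 1.  For alpha = 0 the function has an integrable singularity at
    t = 1 - s and t = 1 + s, so its integrals are taken as improper ones. *)
Definition kernel_integrand (alpha : nat) (h : R -> R) (s t : R) : R :=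
  t * h t / t ^ (2 * alpha)
  * Rpower (((1 + t) ^ 2 - s ^ 2) * ((1 - t) ^ 2 - s ^ 2)) (INR alpha - 1 / 2).

(* Main.v *)
(** In the variable [x = ln t] the function
      w(t) = y_alpha(lambda) j_alpha(lambda t) - j_alpha(lambda) y_alpha(lambda t)
    vanishes at [t = 1], so by uniqueness for the Bessel equation [t^alpha w(t)] is a multiple of
      S(x) = int_0^x J_0(lambda sqrt y) cosh(alpha e) de,   y = 1 + t^2 - 2 t cosh e.
    Integrate [t^(1 - alpha) h(t) J_0(lambda sqrt y) cosh(alpha e)] over the part [y > v] of the
    (t, e)-plane.  For fixed [e], the equation [y = v = s^2] has the two solutions
    [t = cosh e +- sqrt(v + sinh^2 e)], and differentiating in [v] leaves [J_0(lambda s)] times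
    the [cosh(alpha e)]-integral of a weighted difference of the values of [h] at these two
    points.  In the same coordinate [e] the hypothesis is the vanishing of such an integral with
    weight [sinh^(2 alpha) e].  Differentiating in [v] and integrating by parts replaces a weight
    [f] by [(f / sinh)'], and [alpha] such steps turn [sinh^(2 alpha) e] into a multiple of
    [cosh(alpha e)] (Rodrigues' formula for the Chebyshev polynomials). *)

Require Import Defs.
From Stdlib Require Import Reals Lra Lia Factorial.
From Coquelicot Require Import Coquelicot.
Open Scope R_scope.

(** * Riemann integrals with parameters *)

(** With [cosh] in place of [cos], the product in the kernel is the perfect square [(2 t sinh e)^2].
    So the half-integer power becomes rational, and the factor [t sinh e] of [dt] absorbs the
    singularity at [t = 1 - s] and [t = 1 + s]. [J_0(lambda sqrt y)] is the right factor because as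
    a function of [(x, e)] it solves a wave-type equation for [(d/dx)^2 - (d/de)^2]. Pairing it with
    a weight satisfying [w'' = alpha^2 w] therefore gives Bessel's equation of order [alpha]. The
    last weight is carried by this equation and its nonzero value at [0] rather than by a closed
    form. A [v]-derivative always releases the factor of [y] as a constant [Phi v]. Hence [Phi = 1]
    serves in the [alpha] descents and [J_0] enters only in one additional differentiation. The
    obstacle is [v -> 0]: the weight [1 / rt] blows up at [v = e = 0], so all differentiation takes
    place on [0 < v < 1]. The integral over [y > v] is constant there. It is zero for [v] close to
    [1], where the region misses the support of [h], and an explicit bound of order [sqrt v] carries
    this value to [v = 0]. *)

Lemma continuity_2d_section_r (K : R -> R -> R) (x t : R) :
  continuity_2d_pt K x t -> continuous (K x) t.
Proof.
  intros HK.
  apply continuity_pt_filterlim.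
  apply continuity_pt_locally. intros eps.
  destruct (HK eps) as [d Hd]. exists d. intros u Hu.
  apply Hd; [rewrite Rminus_diag, Rabs_R0; apply cond_pos | exact Hu].
Qed.

Lemma continuity_2d_section_l (K : R -> R -> R) (x t : R) :
  continuity_2d_pt K x t -> continuous (fun u => K u t) x.
Proof.
  intros HK.
  apply continuity_pt_filterlim.
  apply continuity_pt_locally. intros eps.
  destruct (HK eps) as [d Hd]. exists d. intros u Hu.
  apply Hd; [exact Hu | rewrite Rminus_diag, Rabs_R0; apply cond_pos].
Qed.

Lemma ex_RInt_continuous_everywhere (f : R -> R) (a b : R) :
  (forall t, continuous f t) -> ex_RInt f a b.
Proof. intros Hf; apply (ex_RInt_continuous (V := R_CompleteNormedModule)); auto. Qed.

Lemma continuous_RInt_param_fixed (K : R -> R -> R) (x : R) :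
  (forall x t, continuity_2d_pt K x t) ->
  continuous (fun u => RInt (K u) 0 1) x.
Proof.
  intros HK.
  apply continuity_pt_filterlim, continuity_pt_locally. intros eps.
  assert (He2 : 0 < eps / 2) by (generalize (cond_pos eps); lra).
  destruct (uniform_continuity_2d_1d' K 0 1 x (fun t _ => HK x t) (mkposreal _ He2))
    as [d Hd].
  exists d. intros u Hu.
  assert (Hex : forall u, ex_RInt (K u) 0 1).
  { intros w. apply ex_RInt_continuous_everywhere. intros t.
    now apply continuity_2d_section_r. }
  change (Rabs (u - x) < d) in Hu. apply Rabs_lt_between in Hu.
  assert (Hb : forall w, 0 <= w <= 1 -> Rabs (K u w - K x w) <= eps / 2).
  { intros w Hw. left. apply (Hd w x w u); try lra.
    all: try rewrite Rminus_diag, Rabs_R0; apply cond_pos || (generalize (cond_pos d); lra). }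
  rewrite <- (RInt_minus (V := R_CompleteNormedModule)); auto.
  apply Rle_lt_trans with (eps / 2); [|generalize (cond_pos eps); lra].
  replace (eps / 2) with ((1 - 0) * (eps / 2)) by ring.
  apply (abs_RInt_le_const (fun w => K u w - K x w) 0 1); auto; try lra.
  apply (ex_RInt_minus (V := R_NormedModule)); auto.
Qed.

Lemma continuity_2d_pt_comp2 (f a b : R -> R -> R) (x t : R) :
  continuity_2d_pt f (a x t) (b x t) ->
  continuity_2d_pt a x t -> continuity_2d_pt b x t ->
  continuity_2d_pt (fun x t => f (a x t) (b x t)) x t.
Proof.
  intros Hf Ha Hb eps.
  destruct (Hf eps) as [d Hd].
  assert (Ha' := Ha d). assert (Hb' := Hb d).
  generalize (locally_2d_and _ _ _ _ Ha' Hb').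
  apply locally_2d_impl, locally_2d_forall. intros u v [H1 H2]. now apply Hd.
Qed.

Lemma continuity_2d_pt_comp1 (f : R -> R) (a : R -> R -> R) (x t : R) :
  continuous f (a x t) -> continuity_2d_pt a x t ->
  continuity_2d_pt (fun x t => f (a x t)) x t.
Proof.
  intros Hf Ha. apply continuity_1d_2d_pt_comp; auto.
  now apply continuity_pt_filterlim.
Qed.

(** The affine substitution onto [[0, 1]] moves the dependence of the bounds into the integrand,
    which reduces the claim to fixed bounds. *)
Lemma continuous_RInt_param (K : R -> R -> R) (a b : R -> R) (x : R) :
  (forall x t, continuity_2d_pt K x t) ->
  (forall x, continuous a x) -> (forall x, continuous b x) ->
  continuous (fun u => RInt (K u) (a u) (b u)) x.
Proof.
  intros HK Ha Hb.
  apply (continuous_ext (fun u => RInt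
    (fun s => (b u - a u) * K u ((b u - a u) * s + a u)) 0 1)).
  { intros u.
    transitivity (RInt (K u) ((b u - a u) * 0 + a u) ((b u - a u) * 1 + a u)).
    - apply (RInt_comp_lin (V := R_CompleteNormedModule)).
      apply ex_RInt_continuous_everywhere. intros t. now apply continuity_2d_section_r.
    - f_equal; ring. }
  apply (continuous_RInt_param_fixed
           (fun u s => (b u - a u) * K u ((b u - a u) * s + a u))).
  intros u s.
  assert (Ha2 : continuity_2d_pt (fun u s => a u) u s).
  { apply (continuity_2d_pt_comp1 a (fun u s => u)); auto. apply continuity_2d_pt_id1. }
  assert (Hba2 : continuity_2d_pt (fun u s => b u - a u) u s).
  { apply continuity_2d_pt_minus; auto.
    apply (continuity_2d_pt_comp1 b (fun u s => u)); auto. apply continuity_2d_pt_id1. }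
  apply continuity_2d_pt_mult; auto.
  apply (continuity_2d_pt_comp2 K (fun u s => u)
           (fun u s => (b u - a u) * s + a u)); auto.
  - apply continuity_2d_pt_id1.
  - apply continuity_2d_pt_plus; auto. apply continuity_2d_pt_mult; auto.
    apply continuity_2d_pt_id2.
Qed.

Lemma is_derive_RInt_param_bounds (f df : R -> R -> R) (a b : R -> R) (x da db : R) :
  (forall x t, is_derive (fun u => f u t) x (df x t)) ->
  (forall x t, continuous (f x) t) ->
  (forall x t, continuity_2d_pt df x t) ->
  is_derive a x da -> is_derive b x db ->
  is_derive (fun u => RInt (f u) (a u) (b u)) x
    (RInt (df x) (a x) (b x) - f x (a x) * da + f x (b x) * db).
Proof.
  intros Hd Hc Hdc Ha Hb.
  assert (HD : forall u v, Derive (fun z => f z v) u = df u v)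
    by (intros; apply is_derive_unique, Hd).
  assert (HD2 : forall u v, continuity_2d_pt (fun u v => Derive (fun z => f z v) u) u v).
  { intros u v. apply continuity_2d_pt_ext with df; auto. }
  assert (Hex : forall u a b, ex_RInt (fun t => f u t) a b).
  { intros. now apply ex_RInt_continuous_everywhere. }
  replace (RInt (df x) (a x) (b x) - f x (a x) * da + f x (b x) * db)
    with (RInt (fun t => Derive (fun u => f u t) x) (a x) (b x)
          + - f x (a x) * da + f x (b x) * db).
  2:{ rewrite (RInt_ext _ (df x)) by (intros; apply HD). ring. }
  apply is_derive_RInt_param_bound_comp; auto.
  - apply filter_forall; auto.
  - exists (mkposreal 1 Rlt_0_1); apply filter_forall; auto.
  - exists (mkposreal 1 Rlt_0_1); apply filter_forall; auto.
  - exists (mkposreal 1 Rlt_0_1); apply filter_forall. intros; eexists; apply Hd.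
  - apply locally_2d_forall; auto.
  - apply locally_2d_forall; auto.
  - apply continuity_pt_filterlim, Hc.
  - apply continuity_pt_filterlim, Hc.
Qed.

(** The strip [u < y < w] is there for [v] in [(0, 1)], where [rt], [xp] and [xm] are smooth. *)
Lemma is_derive_RInt_param_open (f df : R -> R -> R) (u w a b x : R) :
  a <= b -> u < x < w ->
  (forall y t, u < y < w -> is_derive (fun z => f z t) y (df y t)) ->
  (forall y t, u < y < w -> continuous (f y) t) ->
  (forall y t, u < y < w -> continuity_2d_pt df y t) ->
  is_derive (fun y => RInt (f y) a b) x (RInt (df x) a b).
Proof.
  intros Hab Hx Hd Hc Hdc.
  assert (HD : forall u0 v, u < u0 < w -> Derive (fun z => f z v) u0 = df u0 v)
    by (intros; apply is_derive_unique, Hd; assumption).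
  assert (Hloc : locally x (fun y => u < y < w)).
  { apply (locally_interval _ x u w); simpl; tauto || auto. }
  rewrite <- (RInt_ext (fun t => Derive (fun z => f z t) x) (df x))
    by (intros; now apply HD).
  apply is_derive_RInt_param.
  - revert Hloc; apply filter_imp. intros y Hy t _. eexists; now apply Hd.
  - intros t _. apply continuity_2d_pt_ext_loc with df; [|now apply Hdc].
    destruct Hloc as [d Hl]. exists d. intros p q Hp _. symmetry; apply HD, Hl, Hp.
  - revert Hloc; apply filter_imp. intros y Hy.
    apply ex_RInt_continuous_everywhere; auto.
Qed.

(** Both sides vanish at [X = 0] and have derivative [RInt (K X) 0 X]: on the right, the boundary
    term is an integral over the degenerate interval [[X, X]]. *)
Lemma RInt_triangle_swap (K : R -> R -> R) (X : R) :
  0 < X ->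
  (forall x t, continuity_2d_pt K x t) ->
  RInt (fun x => RInt (K x) 0 x) 0 X
  = RInt (fun t => RInt (fun x => K x t) t X) 0 X.
Proof.
  intros HX HK.
  assert (Hsw : forall x t, continuity_2d_pt (fun t x => K x t) x t).
  { intros x t eps. destruct (HK t x eps) as [d Hd]. exists d. intros; now apply Hd. }
  assert (HKx : forall t x, continuous (fun x => K x t) x)
    by (intros; now apply continuity_2d_section_l).
  set (J := fun z => RInt (fun x => RInt (K x) 0 x) 0 z
                     - RInt (fun t => RInt (fun x => K x t) t z) 0 z).
  assert (HJ : forall z, is_derive J z 0).
  { intros z.
    cut (is_derive J z (RInt (K z) 0 z
       - (RInt (K z) 0 z - RInt (fun x => K x 0) 0 z * 0 + RInt (fun x => K x z) z z * 1))).
    { rewrite RInt_point. unfold zero; simpl. intros E.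
      replace 0 with (RInt (K z) 0 z
        - (RInt (K z) 0 z - RInt (fun x => K x 0) 0 z * 0 + 0 * 1)) by ring.
      exact E. }
    apply (is_derive_minus (V := R_NormedModule)).
    - apply (is_derive_RInt (V := R_NormedModule) (fun x => RInt (K x) 0 x) _ 0).
      + apply filter_forall. intros b. apply (RInt_correct (V := R_CompleteNormedModule)).
        apply ex_RInt_continuous_everywhere. intros t.
        apply (continuous_RInt_param K (fun _ => 0) (fun x => x)); auto.
        * intros; apply continuous_const.
        * intros; apply continuous_id.
      + apply (continuous_RInt_param K (fun _ => 0) (fun x => x)); auto.
        * intros; apply continuous_const.
        * intros; apply continuous_id.
    - apply (is_derive_RInt_param_bounds
               (fun z t => RInt (fun x => K x t) t z) K (fun _ => 0) (fun z => z) z 0 1); auto.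
      + intros x t. apply (is_derive_RInt (V := R_NormedModule) (fun x => K x t) _ t).
        * apply filter_forall. intros b. apply (RInt_correct (V := R_CompleteNormedModule)).
          apply ex_RInt_continuous_everywhere; auto.
        * auto.
      + intros x t. apply (continuous_RInt_param (fun t x => K x t) (fun t => t) (fun _ => x)); auto.
        * intros; apply continuous_id.
        * intros; apply continuous_const.
      + apply (is_derive_const (V := R_NormedModule)).
      + apply (is_derive_id (K := R_AbsRing)). }
  assert (H : J 0 = J X) by (apply (eq_is_derive (V := R_NormedModule)); auto).
  unfold J in H. rewrite !RInt_point in H. unfold zero in H; simpl in H. lra.
Qed.

Lemma is_derive_zero_constant (f : R -> R) (a b x y : R) :
  (forall t, a < t < b -> is_derive f t 0) -> a < x < b -> a < y < b -> f x = f y.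
Proof.
  intros Hf Hx Hy.
  destruct (Rtotal_order x y) as [H | [-> | H]]; auto.
  - apply (eq_is_derive (V := R_NormedModule)); auto. intros; apply Hf; lra.
  - symmetry; apply (eq_is_derive (V := R_NormedModule)); auto. intros; apply Hf; lra.
Qed.

(* [Fa] is a neighbourhood filter of [phi 0], approached through [phi]; the
   substitution [t = phi e] removes the singularity of [K] at [phi 0]. *)
Lemma is_RInt_gen_substitution (K phi dphi k : R -> R) (H : R)
    (Fa Fb : (R -> Prop) -> Prop) {FFa : Filter Fa} {FFb : Filter Fb} :
  0 < H ->
  (forall e, 0 < e <= H -> is_derive phi e (dphi e)) ->
  (forall e, 0 < e <= H -> continuous dphi e) ->
  (forall e, 0 < e <= H -> continuous K (phi e)) ->
  (forall e, 0 < e <= H -> ex_RInt K (phi e) (phi H)) ->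
  (forall e, 0 < e <= H -> dphi e * K (phi e) = k e) ->
  (forall e, continuous k e) ->
  (forall d, 0 < d < H -> Fa (fun a => exists e, 0 < e < d /\ a = phi e)) ->
  Fb (fun b => is_RInt K (phi H) b 0) ->
  is_RInt_gen K Fa Fb (RInt k 0 H).
Proof.
  intros HH Hphi Hdphi HK HKex Hk Hkc HFa HFb P [eps HP].
  assert (Hex : forall a b, ex_RInt k a b)
    by (intros; now apply ex_RInt_continuous_everywhere).
  assert (Hc : continuous (fun a => RInt k a H) 0).
  { apply (continuous_RInt_param (fun _ t => k t) (fun a => a) (fun _ => H)).
    - intros x t. apply (continuity_2d_pt_comp1 k (fun _ t => t)); auto.
      apply continuity_2d_pt_id2.
    - intros; apply continuous_id.
    - intros; apply continuous_const. }
  apply continuity_pt_filterlim in Hc.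
  destruct (proj1 (continuity_pt_locally _ _) Hc eps) as [d Hd].
  (* The halves keep [e] strictly below [H] and strictly inside the modulus of continuity [d]. *)
  assert (Hd2 : 0 < Rmin (d / 2) (H / 2) < H).
  { generalize (cond_pos d). intros. split; [apply Rmin_glb_lt; lra|].
    apply Rle_lt_trans with (H / 2); [apply Rmin_r | lra]. }
  apply (Filter_prod _ _ _ _ _ (HFa _ Hd2) HFb).
  intros a b [e [[He He2] ->]] Hb. simpl.
  exists (RInt k e H). split.
  (* From [phi H] to the second bound [K] integrates to zero; from [phi e] to [phi H] the ordinary
     change of variables applies. *)
  - replace (RInt k e H) with (plus (RInt K (phi e) (phi H)) 0).
    + apply (is_RInt_Chasles (V := R_NormedModule) K _ (phi H)); auto.
      apply (RInt_correct (V := R_CompleteNormedModule)), HKex. lra.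
    + unfold plus; simpl. rewrite Rplus_0_r.
      rewrite <- (RInt_comp (V := R_CompleteNormedModule) K phi dphi).
      * apply RInt_ext. intros y. rewrite Rmin_left, Rmax_right by lra.
        intros Hy. apply Hk. lra.
      * intros y. rewrite Rmin_left, Rmax_right by lra. intros Hy. apply HK. lra.
      * intros y. rewrite Rmin_left, Rmax_right by lra.
        intros Hy. split; [apply Hphi | apply Hdphi]; lra.
  - apply HP. apply Hd. change (Rabs (e - 0) < d). rewrite Rminus_0_r, Rabs_pos_eq by lra.
    apply Rlt_le_trans with (1 := He2).
    apply Rle_trans with (d / 2); [apply Rmin_l | generalize (cond_pos d); lra].
Qed.

(** * Bessel functions in the variable z = (x/2)^2 *)

(** For every real [r] the terms [a n * r ^ n] are bounded, since [r ^ n / n!] tends to [0]; so the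
    radius exceeds every real number. *)
Lemma CV_radius_factorial_bound (a : nat -> R) (C : R) :
  (forall k, Rabs (a k) <= C / INR (fact k)) -> CV_radius a = p_infty.
Proof.
  intros Ha.
  assert (HC : 0 <= C).
  { generalize (Ha 0%nat) (Rabs_pos (a 0%nat)). simpl. lra. }
  destruct (CV_radius_bounded a) as [Hub _].
  assert (Hr : forall r : R, Rbar_le r (CV_radius a)).
  { intros r. apply (Hub r).
    destruct (filterlim_bounded (V := R_NormedModule) (fun n => r ^ n / INR (fact n))) as [M HM].
    { exists 0. apply is_lim_seq_Reals, cv_speed_pow_fact. }
    exists (C * M). intros n. rewrite Rabs_mult.
    apply Rle_trans with (C / INR (fact n) * Rabs (r ^ n)).
    - apply Rmult_le_compat_r; [apply Rabs_pos | apply Ha].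
    - replace (C / INR (fact n) * Rabs (r ^ n)) with (C * Rabs (r ^ n / INR (fact n))).
      + apply Rmult_le_compat_l; [exact HC | apply HM].
      + unfold Rdiv. rewrite Rabs_mult, (Rabs_pos_eq (/ INR (fact n))).
        * ring.
        * left; apply Rinv_0_lt_compat, INR_fact_lt_0. }
  destruct (CV_radius a) as [r | |]; auto.
  - specialize (Hr (r + 1)). simpl in Hr. lra.
  - now specialize (Hr 0).
Qed.

Definition bessel_coef (n k : nat) : R := (-1) ^ k / (INR (fact k) * INR (fact (n + k))).

Definition bessel_log_coef (n k : nat) : R := (psi_S k + psi_S (n + k)) * bessel_coef n k.

(** This is [z A'' + (n + 1) A' + A = 0] read off coefficient by coefficient. *)
Lemma bessel_coef_succ (n k : nat) :
  INR (S k) * (INR (S k) + INR n) * bessel_coef n (S k) = - bessel_coef n k.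
Proof.
  unfold bessel_coef. rewrite Nat.add_succ_r, !fact_simpl, !mult_INR.
  replace (INR (S (n + k))) with (INR (S k) + INR n) by (rewrite <- plus_INR; f_equal; lia).
  generalize (INR_fact_neq_0 k) (INR_fact_neq_0 (n + k)) (pos_INR n) (pos_INR k). intros.
  rewrite S_INR. simpl pow. field. repeat split; auto; lra.
Qed.

Lemma harmonic_succ (k : nat) : harmonic (S k) = harmonic k + / INR (S k).
Proof. unfold harmonic. rewrite sum_n_Sm by lia. reflexivity. Qed.

Lemma psi_S_succ (k : nat) : psi_S (S k) = psi_S k + / INR (S k).
Proof. unfold psi_S. rewrite harmonic_succ. ring. Qed.

Lemma psi_S_bound (k : nat) : Rabs (psi_S k) <= INR k + Rabs euler_gamma.
Proof.
  assert (H : 0 <= harmonic k <= INR k).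
  { induction k as [|k IH].
    - unfold harmonic. rewrite sum_n_m_zero by lia. unfold zero; simpl; lra.
    - rewrite harmonic_succ. generalize (pos_INR k). intros.
      assert (0 < / INR (S k)) by (apply Rinv_0_lt_compat; rewrite S_INR; lra).
      assert (/ INR (S k) <= 1)
        by (rewrite <- Rinv_1; apply Rinv_le_contravar; rewrite ?S_INR; lra).
      rewrite S_INR in *; lra. }
  unfold psi_S. eapply Rle_trans; [apply Rabs_triang|].
  rewrite Rabs_Ropp, Rabs_pos_eq; lra.
Qed.

Lemma Rabs_bessel_coef (n k : nat) :
  Rabs (bessel_coef n k) = / INR (fact (n + k)) * / INR (fact k).
Proof.
  unfold bessel_coef, Rdiv. rewrite Rabs_mult, pow_1_abs, Rinv_mult.
  rewrite Rabs_pos_eq; [ring|].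
  generalize (Rinv_0_lt_compat _ (INR_fact_lt_0 k))
    (Rinv_0_lt_compat _ (INR_fact_lt_0 (n + k))). nra.
Qed.

Lemma INR_fact_ge_1 (k : nat) : 1 <= INR (fact k).
Proof. apply (le_INR 1). apply lt_O_fact. Qed.

Lemma INR_le_fact (k : nat) : INR k <= INR (fact k).
Proof.
  apply le_INR. destruct k as [|k]; [simpl; lia|].
  rewrite fact_simpl. generalize (lt_O_fact k). nia.
Qed.

Lemma CV_radius_bessel_coef (n : nat) : CV_radius (bessel_coef n) = p_infty.
Proof.
  apply CV_radius_factorial_bound with 1. intros k. rewrite Rabs_bessel_coef.
  apply Rmult_le_compat_r; [left; apply Rinv_0_lt_compat, INR_fact_lt_0|].
  rewrite <- Rinv_1. apply Rinv_le_contravar; [lra | apply INR_fact_ge_1].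
Qed.

(** The linear growth of the digamma factors is absorbed by [(n + k)!], which leaves [k!] for the
    factorial criterion. *)
Lemma CV_radius_bessel_log_coef (n : nat) : CV_radius (bessel_log_coef n) = p_infty.
Proof.
  apply CV_radius_factorial_bound with (2 + 2 * Rabs euler_gamma). intros k.
  unfold bessel_log_coef. rewrite Rabs_mult, Rabs_bessel_coef, <- Rmult_assoc.
  apply Rmult_le_compat_r; [left; apply Rinv_0_lt_compat, INR_fact_lt_0|].
  apply Rmult_le_reg_r with (INR (fact (n + k))); [apply INR_fact_lt_0|].
  rewrite Rmult_assoc, Rinv_l, Rmult_1_r by apply INR_fact_neq_0.
  generalize (Rabs_triang (psi_S k) (psi_S (n + k))) (psi_S_bound k) (psi_S_bound (n + k))
    (INR_fact_ge_1 (n + k)) (INR_le_fact (n + k)) (Rabs_pos euler_gamma) (pos_INR n).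
  rewrite plus_INR. intros. nra.
Qed.

Lemma ex_pseries_entire (a : nat -> R) (z : R) : CV_radius a = p_infty -> ex_pseries a z.
Proof. intros H. apply CV_radius_inside. rewrite H. exact I. Qed.

Lemma CV_radius_derive_entire (a : nat -> R) :
  CV_radius a = p_infty -> CV_radius (PS_derive a) = p_infty.
Proof. now rewrite CV_radius_derive. Qed.

Lemma is_derive_PSeries_entire (a : nat -> R) (z : R) :
  CV_radius a = p_infty -> is_derive (PSeries a) z (PSeries (PS_derive a) z).
Proof. intros H. apply is_derive_PSeries. now rewrite H. Qed.

(** On coefficients the Bessel operator is a two-term recurrence. This form serves both the entire
    solution and the logarithmic series. *)
Lemma bessel_operator_PSeries (n : nat) (c : nat -> R) (z : R) :
  CV_radius c = p_infty ->
  z * PSeries (PS_derive (PS_derive c)) z + (INR n + 1) * PSeries (PS_derive c) z + PSeries c z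
  = PSeries (fun k => INR (S k) * (INR (S k) + INR n) * c (S k) + c k) z.
Proof.
  intros Hc.
  assert (Hc1 := CV_radius_derive_entire _ Hc).
  assert (Hc2 := CV_radius_derive_entire _ Hc1).
  rewrite <- PSeries_incr_1, <- PSeries_scal.
  rewrite <- PSeries_plus, <- PSeries_plus.
  - apply PSeries_ext. intros k.
    unfold PS_plus, PS_scal, PS_incr_1, PS_derive, plus, scal; simpl; unfold mult; simpl.
    destruct k as [|k]; [unfold zero; simpl; ring|].
    change (match k with 0%nat => 1 | S _ => INR k + 1 end) with (INR (S k)).
    rewrite !S_INR. ring.
  - apply ex_pseries_plus.
    + apply ex_pseries_incr_1. now apply ex_pseries_entire.
    + apply ex_pseries_scal; [apply Rmult_comm | now apply ex_pseries_entire].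
  - now apply ex_pseries_entire.
  - apply ex_pseries_incr_1. now apply ex_pseries_entire.
  - apply ex_pseries_scal; [apply Rmult_comm | now apply ex_pseries_entire].
Qed.

(** A Bessel-Clifford function, at the argument [- z]: [J_n(x) = (x / 2)^n besselA n ((x / 2)^2)].
    It is entire in [z]. *)
Definition besselA (n : nat) : R -> R := PSeries (bessel_coef n).
Definition besselA' (n : nat) : R -> R := PSeries (PS_derive (bessel_coef n)).
Definition besselA'' (n : nat) : R -> R := PSeries (PS_derive (PS_derive (bessel_coef n))).

Lemma is_derive_besselA (n : nat) (z : R) : is_derive (besselA n) z (besselA' n z).
Proof. apply is_derive_PSeries_entire, CV_radius_bessel_coef. Qed.

Lemma is_derive_besselA' (n : nat) (z : R) : is_derive (besselA' n) z (besselA'' n z).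
Proof. apply is_derive_PSeries_entire, CV_radius_derive_entire, CV_radius_bessel_coef. Qed.

Lemma continuous_besselA'' (n : nat) (z : R) : continuous (besselA'' n) z.
Proof.
  apply (ex_derive_continuous (V := R_NormedModule)).
  eexists. apply is_derive_PSeries_entire.
  apply CV_radius_derive_entire, CV_radius_derive_entire, CV_radius_bessel_coef.
Qed.

Lemma besselA_ode (n : nat) (z : R) :
  z * besselA'' n z + (INR n + 1) * besselA' n z + besselA n z = 0.
Proof.
  unfold besselA, besselA', besselA''.
  rewrite bessel_operator_PSeries by apply CV_radius_bessel_coef.
  rewrite (PSeries_ext _ (fun _ => 0)).
  - apply PSeries_const_0.
  - intros k. rewrite bessel_coef_succ. ring.
Qed.

Lemma besselA_0 (n : nat) : besselA n 0 = / INR (fact n).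
Proof.
  unfold besselA. rewrite PSeries_0. unfold bessel_coef.
  rewrite Nat.add_0_r. simpl. field. apply INR_fact_neq_0.
Qed.

(** The digamma factors grow by [1 / (k + 1)] and [1 / (n + k + 1)] from one index to the next. What
    survives in the recurrence is therefore [2 (k + 1) + n] times [bessel_coef n (k + 1)], which is
    the right-hand side. *)
Lemma bessel_log_operator (n : nat) (z : R) :
  z * PSeries (PS_derive (PS_derive (bessel_log_coef n))) z
  + (INR n + 1) * PSeries (PS_derive (bessel_log_coef n)) z + PSeries (bessel_log_coef n) z
  = 2 * besselA' n z + INR n * PSeries (PS_decr_1 (bessel_coef n)) z.
Proof.
  rewrite bessel_operator_PSeries by apply CV_radius_bessel_log_coef.
  unfold besselA'. rewrite <- !PSeries_scal, <- PSeries_plus.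
  - apply PSeries_ext. intros k.
    unfold PS_plus, PS_scal, PS_decr_1, PS_derive, plus, scal, bessel_log_coef;
      simpl plus; simpl scal; unfold mult; simpl mult.
    rewrite Nat.add_succ_r, !psi_S_succ.
    replace (bessel_coef n k) with
      (- (INR (S k) * (INR (S k) + INR n) * bessel_coef n (S k)))
      by (rewrite bessel_coef_succ; ring).
    replace (INR (S (n + k))) with (INR (S k) + INR n) by (rewrite <- plus_INR; f_equal; lia).
    unfold zero, scal; simpl. unfold mult; simpl.
    change (match k with 0%nat => 1 | S _ => INR k + 1 end) with (INR (S k)).
    generalize (pos_INR n) (pos_INR k). intros. rewrite S_INR.
    field. lra.
  - apply ex_pseries_scal; [apply Rmult_comm|].
    apply ex_pseries_entire, CV_radius_derive_entire, CV_radius_bessel_coef.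
  - apply ex_pseries_scal; [apply Rmult_comm|].
    apply ex_pseries_entire. rewrite CV_radius_decr_1. apply CV_radius_bessel_coef.
Qed.

(* Bessel's equation for [x^-n J_n] and [x^-n Y_n], written in z = (x/2)^2. *)
Definition bessel_sol (n : nat) (V V' V'' : R -> R) : Prop :=
  forall z, 0 < z -> is_derive V z (V' z) /\ is_derive V' z (V'' z) /\
    z * V'' z + (INR n + 1) * V' z + V z = 0.

(** * The polar part of the second solution *)

Definition principal_coef (m k : nat) : R := INR (fact (m - k)) / INR (fact k).

Definition principal_part (n : nat) (z : R) : R :=
  match n with
  | O => 0
  | S m => sum_f_R0 (fun k => principal_coef m k * (z ^ k / z ^ n)) m
  end.

Lemma is_derive_sum_f_R0 (f f' : nat -> R -> R) (m : nat) (z : R) :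
  (forall k, is_derive (f k) z (f' k z)) ->
  is_derive (fun z => sum_f_R0 (fun k => f k z) m) z (sum_f_R0 (fun k => f' k z) m).
Proof.
  intros H. induction m as [|m IH]; simpl; auto.
  apply (is_derive_plus (V := R_NormedModule)); auto.
Qed.

Lemma is_derive_pow_ratio (c : R) (k n : nat) (z : R) : 0 < z ->
  is_derive (fun z => c * (z ^ k / z ^ n)) z (c * (INR k - INR n) * (z ^ k / z ^ S n)).
Proof.
  intros Hz.
  auto_derive.
  - apply pow_nonzero; lra.
  - assert (z ^ n <> 0) by (apply pow_nonzero; lra).
    destruct k as [|k]; destruct n as [|n]; simpl pred; simpl pow;
      try assert (z ^ n <> 0) by (apply pow_nonzero; lra);
      simpl (INR 0); try field; repeat split; auto; lra.
Qed.

Definition principal_part' (n : nat) (z : R) : R :=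
  match n with
  | O => 0
  | S m => sum_f_R0 (fun k => principal_coef m k * (INR k - INR n) * (z ^ k / z ^ S n)) m
  end.

Definition principal_part'' (n : nat) (z : R) : R :=
  match n with
  | O => 0
  | S m => sum_f_R0 (fun k => principal_coef m k * (INR k - INR n) * (INR k - INR (S n))
                              * (z ^ k / z ^ S (S n))) m
  end.

Lemma is_derive_principal_part (n : nat) (z : R) : 0 < z ->
  is_derive (principal_part n) z (principal_part' n z).
Proof.
  intros Hz. destruct n as [|m]; [apply (is_derive_const (V := R_NormedModule))|].
  apply (is_derive_sum_f_R0 (fun k z => principal_coef m k * (z ^ k / z ^ S m))
    (fun k z => principal_coef m k * (INR k - INR (S m)) * (z ^ k / z ^ S (S m)))).
  intros k. now apply is_derive_pow_ratio.
Qed.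

Lemma is_derive_principal_part' (n : nat) (z : R) : 0 < z ->
  is_derive (principal_part' n) z (principal_part'' n z).
Proof.
  intros Hz. destruct n as [|m]; [apply (is_derive_const (V := R_NormedModule))|].
  apply (is_derive_sum_f_R0
    (fun k z => principal_coef m k * (INR k - INR (S m)) * (z ^ k / z ^ S (S m)))
    (fun k z => principal_coef m k * (INR k - INR (S m)) * (INR k - INR (S (S m)))
                * (z ^ k / z ^ S (S (S m))))).
  intros k. now apply is_derive_pow_ratio.
Qed.

Lemma principal_part_operator (n : nat) (z : R) : 0 < z ->
  z * principal_part'' n z + (INR n + 1) * principal_part' n z + principal_part n z
  = INR n * bessel_coef n 0 / z.
Proof.
  intros Hz. destruct n as [|m]; [simpl; field; lra|].
  unfold principal_part, principal_part', principal_part''.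
  assert (Hz' : forall k, z ^ k <> 0) by (intros; apply pow_nonzero; lra).
  (* The sum telescopes. The two derivative terms map [z^(k - n)] to [k (k - n) z^(k - n - 1)],
     which is zero for [k = 0] and otherwise cancels the undifferentiated term of index [k - 1].
     Only the last undifferentiated term remains. *)
  assert (H : forall j, (j <= m)%nat ->
    z * sum_f_R0 (fun k => principal_coef m k * (INR k - INR (S m)) * (INR k - INR (S (S m)))
                    * (z ^ k / z ^ S (S (S m)))) j
    + (INR (S m) + 1) * sum_f_R0 (fun k => principal_coef m k * (INR k - INR (S m))
                    * (z ^ k / z ^ S (S m))) j
    + sum_f_R0 (fun k => principal_coef m k * (z ^ k / z ^ S m)) j
    = principal_coef m j * (z ^ S j / z ^ S (S m))).
  { induction j as [|j IH]; intros Hj.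
    - cbn [sum_f_R0]. rewrite (S_INR (S m)). change (INR 0) with 0. cbn [pow]. field.
      split; [apply Hz' | lra].
    - rewrite !tech5.
      assert (Hp : principal_coef m j = principal_coef m (S j) * INR (S j) * (INR (S m) - INR (S j))).
      { unfold principal_coef. replace (m - j)%nat with (S (m - S j)) by lia.
        rewrite !fact_simpl, !mult_INR.
        rewrite <- minus_INR by lia. replace (S m - S j)%nat with (S (m - S j)) by lia.
        field. split; [apply INR_fact_neq_0 | apply not_0_INR; lia]. }
      specialize (IH ltac:(lia)).
      set (s1 := sum_f_R0 _ _) in IH |- *. set (s2 := sum_f_R0 _ _) in IH |- *.
      set (s3 := sum_f_R0 _ _) in IH |- *.
      match goal with |- ?l = _ => replace l with (z * s1 + (INR (S m) + 1) * s2 + s3 +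
        (z * (principal_coef m (S j) * (INR (S j) - INR (S m)) * (INR (S j) - INR (S (S m)))
                * (z ^ S j / z ^ S (S (S m))))
         + (INR (S m) + 1) * (principal_coef m (S j) * (INR (S j) - INR (S m))
                * (z ^ S j / z ^ S (S m)))
         + principal_coef m (S j) * (z ^ S j / z ^ S m))) by ring end.
      rewrite IH, Hp, (S_INR (S m)). cbn [pow]. field. split; [apply Hz' | lra]. }
  rewrite H by lia. unfold principal_coef, bessel_coef.
  rewrite Nat.sub_diag, Nat.add_0_r, fact_simpl, mult_INR. cbn [pow].
  change (INR (fact 0)) with 1. field. repeat split; try lra; try apply Hz'; try apply INR_fact_neq_0.
  apply not_0_INR; lia.
Qed.

(** This is [PI * Y_n(x) / (x / 2)^n] at [z = (x / 2)^2]; the factor [2 ln (x / 2)] has become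
    [ln z]. *)
Definition besselU (n : nat) (z : R) : R :=
  ln z * besselA n z - principal_part n z - PSeries (bessel_log_coef n) z.
Definition besselU' (n : nat) (z : R) : R :=
  (/ z * besselA n z + ln z * besselA' n z) - principal_part' n z
  - PSeries (PS_derive (bessel_log_coef n)) z.
Definition besselU'' (n : nat) (z : R) : R :=
  ((- / z ^ 2) * besselA n z + / z * besselA' n z + (/ z * besselA' n z + ln z * besselA'' n z))
  - principal_part'' n z - PSeries (PS_derive (PS_derive (bessel_log_coef n))) z.

Lemma bessel_sol_A (n : nat) : bessel_sol n (besselA n) (besselA' n) (besselA'' n).
Proof.
  intros z _.
  auto using is_derive_besselA, is_derive_besselA', besselA_ode.
Qed.

Lemma bessel_sol_U (n : nat) : bessel_sol n (besselU n) (besselU' n) (besselU'' n).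
Proof.
  intros z Hz.
  assert (Hln : is_derive ln z (/ z)) by (apply is_derive_Reals, derivable_pt_lim_ln, Hz).
  assert (Hinv : is_derive Rinv z (- / z ^ 2)) by (auto_derive; [lra | field; lra]).
  split; [|split].
  - apply (is_derive_minus (V := R_NormedModule)); [apply (is_derive_minus (V := R_NormedModule))|].
    + apply (is_derive_mult (K := R_AbsRing)); [exact Hln | apply is_derive_besselA | apply Rmult_comm].
    + now apply is_derive_principal_part.
    + apply is_derive_PSeries_entire, CV_radius_bessel_log_coef.
  - apply (is_derive_minus (V := R_NormedModule)); [apply (is_derive_minus (V := R_NormedModule))|].
    + apply (is_derive_plus (V := R_NormedModule)).
      * apply (is_derive_mult (K := R_AbsRing)); [exact Hinv | apply is_derive_besselA | apply Rmult_comm].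
      * apply (is_derive_mult (K := R_AbsRing)); [exact Hln | apply is_derive_besselA' | apply Rmult_comm].
    + now apply is_derive_principal_part'.
    + apply is_derive_PSeries_entire, CV_radius_derive_entire, CV_radius_bessel_log_coef.
  - assert (HA := besselA_ode n z). assert (HP := principal_part_operator n z Hz).
    assert (HB := bessel_log_operator n z).
    assert (Hd : besselA n z = bessel_coef n 0 + z * PSeries (PS_decr_1 (bessel_coef n)) z).
    { apply PSeries_decr_1, ex_pseries_entire, CV_radius_bessel_coef. }
    unfold besselU, besselU', besselU''.
    set (B := PSeries (bessel_log_coef n) z) in *.
    set (B1 := PSeries (PS_derive (bessel_log_coef n)) z) in *.
    set (B2 := PSeries (PS_derive (PS_derive (bessel_log_coef n))) z) in *.
    (* Besides [ln z] times the equation of [besselA], the product rule leaves [2 A' + n A / z]. The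
       polar part cancels the contribution of the constant coefficient of [A] to [n A / z], and the
       logarithmic series cancels the rest. *)
    match goal with |- ?l = 0 => replace l with
      (ln z * (z * besselA'' n z + (INR n + 1) * besselA' n z + besselA n z)
       + (2 * besselA' n z + INR n * besselA n z / z)
       - (z * principal_part'' n z + (INR n + 1) * principal_part' n z + principal_part n z)
       - (z * B2 + (INR n + 1) * B1 + B)) by (field; lra) end.
    rewrite HA, HP, HB, Hd. field. lra.
Qed.

Lemma besselJ_eq (n : nat) (x : R) : besselJ n x = (x / 2) ^ n * besselA n ((x / 2) ^ 2).
Proof.
  unfold besselJ, besselA, PSeries. rewrite <- Series_scal_l. apply Series_ext. intros k.
  unfold bessel_coef. rewrite pow_add, pow_mult. ring.
Qed.

Lemma nbesselJ_eq (n : nat) (x : R) : 0 < x ->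
  nbesselJ n x = INR (fact n) * besselA n ((x / 2) ^ 2).
Proof.
  intros Hx. unfold nbesselJ. rewrite besselJ_eq.
  replace ((x / 2) ^ n) with (x ^ n / 2 ^ n) by (unfold Rdiv; rewrite Rpow_mult_distr, pow_inv; reflexivity).
  field. split; apply pow_nonzero; lra.
Qed.

Lemma besselY_principal_eq (n : nat) (x : R) : 0 < x ->
  besselY_principal n x = (x / 2) ^ n * principal_part n ((x / 2) ^ 2).
Proof.
  intros Hx. destruct n as [|m]; [simpl; ring|].
  unfold besselY_principal, principal_part. rewrite scal_sum. apply sum_eq. intros k _.
  unfold principal_coef. rewrite <- !pow_mult.
  replace (2 * S m)%nat with (S m + S m)%nat by lia. rewrite (pow_add _ (S m) (S m)).
  field. split; [|apply INR_fact_neq_0]. apply pow_nonzero; lra.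
Qed.

Lemma nbesselY_eq (n : nat) (x : R) : 0 < x ->
  nbesselY n x = INR (fact n) / PI * besselU n ((x / 2) ^ 2).
Proof.
  intros Hx. unfold nbesselY, besselY, besselU.
  rewrite besselJ_eq, (besselY_principal_eq n x Hx).
  replace (Series _) with ((x / 2) ^ n * PSeries (bessel_log_coef n) ((x / 2) ^ 2)).
  2:{ unfold PSeries. rewrite <- Series_scal_l. apply Series_ext. intros k.
      unfold bessel_log_coef, bessel_coef. rewrite pow_add, pow_mult. ring. }
  assert (Hl : ln ((x / 2) ^ 2) = 2 * ln (x / 2)).
  { rewrite ln_pow by lra. simpl. ring. }
  rewrite Hl.
  replace ((x / 2) ^ n) with (x ^ n / 2 ^ n) by (unfold Rdiv; rewrite Rpow_mult_distr, pow_inv; reflexivity).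
  field. repeat split; try (apply pow_nonzero; lra). apply PI_neq0.
Qed.

(** * The coordinates (v, e) *)

(* The second component is the derivative of the first.  The recursion makes the weights
   [f m e = sinh e ^ (2 (a - m)) * fst (gegen a m) (cosh e)] satisfy [f (m + 1) = (f m / sinh)'];
   [fst (gegen a a)] is a multiple of the Chebyshev polynomial [T_a]. *)
Fixpoint gegen (a : R) (m : nat) : (R -> R) * (R -> R) :=
  match m with
  | O => (fun _ => 1, fun _ => 0)
  | S k =>
      let n := a - INR k in
      (fun x => (2 * n - 1) * x * fst (gegen a k) x + (x ^ 2 - 1) * snd (gegen a k) x,
       fun x => (a ^ 2 - (n - 1) ^ 2) * fst (gegen a k) x)
  end.

Definition gegen'' (a : R) (m : nat) (x : R) : R :=
  match m with
  | O => 0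
  | S k => (a ^ 2 - (a - INR k - 1) ^ 2) * snd (gegen a k) x
  end.

(** Gegenbauer's equation with parameter [a - m]. It holds identically by the form of the recursion,
    and it is what makes the second component of the next pair the derivative of the first. For
    [m = a] it is Chebyshev's equation. *)
Lemma gegen_ode (a : R) (m : nat) (x : R) :
  (x ^ 2 - 1) * gegen'' a m x + (2 * (a - INR m) + 1) * x * snd (gegen a m) x
  + ((a - INR m) ^ 2 - a ^ 2) * fst (gegen a m) x = 0.
Proof.
  destruct m as [|k].
  - simpl. ring.
  - rewrite S_INR. cbn [gegen gegen'' fst snd]. ring.
Qed.

Lemma is_derive_gegen (a : R) (m : nat) (x : R) :
  is_derive (fst (gegen a m)) x (snd (gegen a m) x) /\
  is_derive (snd (gegen a m)) x (gegen'' a m x).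
Proof.
  induction m as [|k [IH1 IH2]].
  - split; exact (is_derive_const (K := R_AbsRing) (V := R_NormedModule) _ x).
  - cbn [gegen gegen'' fst snd]. split.
    + assert (Ho := gegen_ode a k x).
      set (q := fst (gegen a k)) in *. set (q1 := snd (gegen a k)) in *.
      auto_derive; [repeat split; eexists; eassumption|].
      replace (Derive (fun x0 : R => q x0) x) with (q1 x)
        by (symmetry; apply is_derive_unique, IH1).
      replace (Derive (fun x0 : R => q1 x0) x) with (gegen'' a k x)
        by (symmetry; apply is_derive_unique, IH2).
      lra.
    + now apply is_derive_scal.
Qed.

(** At [1] the term with [x^2 - 1] drops out, and the value is the product of the numbers
    [2 (a - k) - 1] with [k < m], all at least [1]. For [m = a] this value is the divisor that
    normalizes the comparison with [S]. *)
Lemma gegen_one (a m : nat) : (m <= a)%nat -> fst (gegen (INR a) m) 1 <> 0.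
Proof.
  induction m as [|k IH]; intros Hm; cbn [gegen fst].
  - lra.
  - replace (1 ^ 2 - 1) with 0 by ring. rewrite Rmult_0_l, Rplus_0_r, Rmult_1_r.
    apply Rmult_integral_contrapositive. split; [|apply IH; lia].
    apply le_INR in Hm. rewrite S_INR in Hm. lra.
Qed.

Lemma cosh_sinh_sq (e : R) : cosh e ^ 2 = 1 + sinh e ^ 2.
Proof.
  unfold cosh, sinh. assert (H : exp e * exp (- e) = 1) by (rewrite <- exp_plus, Rplus_opp_r; apply exp_0).
  nra.
Qed.

Lemma cosh_ge_1 (e : R) : 1 <= cosh e.
Proof.
  assert (H : 0 < cosh e).
  { unfold cosh. generalize (exp_pos e) (exp_pos (- e)). lra. }
  generalize (cosh_sinh_sq e) (pow2_ge_0 (sinh e)). nra.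
Qed.

Lemma sinh_nonneg (e : R) : 0 <= e -> 0 <= sinh e.
Proof. intros [H | <-]; [|rewrite sinh_0; lra]. rewrite <- sinh_0. left. now apply sinh_lt. Qed.

Lemma is_derive_cosh (e : R) : is_derive cosh e (sinh e).
Proof. apply is_derive_Reals, derivable_pt_lim_cosh. Qed.

Lemma is_derive_sinh (e : R) : is_derive sinh e (cosh e).
Proof. apply is_derive_Reals, derivable_pt_lim_sinh. Qed.

Lemma continuous_cosh (e : R) : continuous cosh e.
Proof. apply (ex_derive_continuous (V := R_NormedModule)). eexists; apply is_derive_cosh. Qed.

Lemma continuous_sinh (e : R) : continuous sinh e.
Proof. apply (ex_derive_continuous (V := R_NormedModule)). eexists; apply is_derive_sinh. Qed.

(* [yy x e] is the squared side opposite to the angle [i e] in the triangle with sides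
   [1] and [exp x]; the solutions [x] of [yy x e = v] are [xp v e] and [xm v e]. *)
Definition yy (x e : R) : R := 1 + exp x ^ 2 - 2 * exp x * cosh e.
Definition rt (v e : R) : R := sqrt (v + sinh e ^ 2).
Definition xp (v e : R) : R := ln (cosh e + rt v e).
Definition xm (v e : R) : R := ln (cosh e - rt v e).

Lemma rt_pos (v e : R) : 0 < v -> 0 < rt v e.
Proof. intros Hv. apply sqrt_lt_R0. generalize (pow2_ge_0 (sinh e)). lra. Qed.

Lemma rt_sq (v e : R) : 0 < v -> rt v e ^ 2 = v + sinh e ^ 2.
Proof.
  intros Hv. unfold rt. rewrite <- Rsqr_pow2. apply Rsqr_sqrt.
  generalize (pow2_ge_0 (sinh e)). lra.
Qed.

Lemma rt_lt_cosh (v e : R) : 0 < v < 1 -> rt v e < cosh e.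
Proof.
  intros Hv. generalize (rt_sq v e (proj1 Hv)) (rt_pos v e (proj1 Hv)) (cosh_sinh_sq e) (cosh_ge_1 e).
  nra.
Qed.

Lemma exp_xp (v e : R) : 0 < v -> exp (xp v e) = cosh e + rt v e.
Proof. intros Hv. apply exp_ln. generalize (rt_pos v e Hv) (cosh_ge_1 e). lra. Qed.

Lemma exp_xm (v e : R) : 0 < v < 1 -> exp (xm v e) = cosh e - rt v e.
Proof. intros Hv. apply exp_ln. generalize (rt_lt_cosh v e Hv). lra. Qed.

Lemma yy_xp (v e : R) : 0 < v -> yy (xp v e) e = v.
Proof.
  intros Hv. unfold yy. rewrite exp_xp by lra.
  generalize (rt_sq v e Hv) (cosh_sinh_sq e). nra.
Qed.

Lemma yy_xm (v e : R) : 0 < v < 1 -> yy (xm v e) e = v.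
Proof.
  intros Hv. unfold yy. rewrite exp_xm by lra.
  generalize (rt_sq v e (proj1 Hv)) (cosh_sinh_sq e). nra.
Qed.

(** The roots of [t^2 - 2 t cosh e + 1 - v] have product [1 - v]. This turns bounds on [xp] into
    bounds on [xm]. *)
Lemma xp_add_xm (v e : R) : 0 < v < 1 -> xp v e + xm v e = ln (1 - v).
Proof.
  intros Hv. unfold xp, xm.
  generalize (rt_lt_cosh v e Hv) (rt_pos v e (proj1 Hv)) (rt_sq v e (proj1 Hv)) (cosh_sinh_sq e).
  intros. rewrite <- ln_mult by lra. f_equal. nra.
Qed.

Lemma is_derive_rt_l (v e : R) : 0 < v -> is_derive (fun v => rt v e) v (/ (2 * rt v e)).
Proof.
  intros Hv. assert (H := rt_pos v e Hv). unfold rt in *.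
  auto_derive; [generalize (pow2_ge_0 (sinh e)); simpl; lra|].
  replace (sinh e * (sinh e * 1)) with (sinh e ^ 2) by ring. field. lra.
Qed.

Lemma is_derive_rt_r (v e : R) : 0 < v ->
  is_derive (rt v) e (sinh e * cosh e / rt v e).
Proof.
  intros Hv. assert (H := rt_pos v e Hv). unfold rt in *.
  auto_derive; [generalize (pow2_ge_0 (sinh e)); simpl; lra|].
  replace (sinh e * (sinh e * 1)) with (sinh e ^ 2) by ring. field. lra.
Qed.

Lemma is_derive_ln_comp (f : R -> R) (x l : R) :
  0 < f x -> is_derive f x l -> is_derive (fun x => ln (f x)) x (l / f x).
Proof.
  intros Hf Hd. auto_derive; [split; [eexists; eassumption | auto]|].
  
  replace (Derive (fun x0 : R => f x0) x) with l by (symmetry; apply is_derive_unique, Hd).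
  field. lra.
Qed.

Lemma is_derive_xp_l (v e : R) : 0 < v ->
  is_derive (fun v => xp v e) v (exp (- xp v e) / (2 * rt v e)).
Proof.
  intros Hv. generalize (rt_pos v e Hv) (cosh_ge_1 e). intros.
  replace (exp (- xp v e) / (2 * rt v e)) with (/ (2 * rt v e) / (cosh e + rt v e))
    by (rewrite exp_Ropp, exp_xp by lra; field; lra).
  apply (is_derive_ln_comp (fun v => cosh e + rt v e)); [lra|].
  rewrite <- (Rplus_0_l (/ _)). apply (is_derive_plus (V := R_NormedModule)).
  - apply (is_derive_const (V := R_NormedModule)).
  - now apply is_derive_rt_l.
Qed.

Lemma is_derive_xm_l (v e : R) : 0 < v < 1 ->
  is_derive (fun v => xm v e) v (- (exp (- xm v e) / (2 * rt v e))).
Proof.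
  intros Hv. generalize (rt_pos v e (proj1 Hv)) (rt_lt_cosh v e Hv). intros.
  replace (- (exp (- xm v e) / (2 * rt v e))) with ((0 - / (2 * rt v e)) / (cosh e - rt v e))
    by (rewrite exp_Ropp, exp_xm by lra; field; lra).
  apply (is_derive_ln_comp (fun v => cosh e - rt v e)); [lra|].
  apply (is_derive_minus (V := R_NormedModule)).
  - apply (is_derive_const (V := R_NormedModule)).
  - now apply is_derive_rt_l.
Qed.

Lemma is_derive_xp_r (v e : R) : 0 < v -> is_derive (xp v) e (sinh e / rt v e).
Proof.
  intros Hv. generalize (rt_pos v e Hv) (cosh_ge_1 e). intros.
  replace (sinh e / rt v e) with ((sinh e + sinh e * cosh e / rt v e) / (cosh e + rt v e))
    by (field; lra).
  apply (is_derive_ln_comp (fun e => cosh e + rt v e)); [lra|].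
  apply (is_derive_plus (V := R_NormedModule)); [apply is_derive_cosh | now apply is_derive_rt_r].
Qed.

Lemma is_derive_xm_r (v e : R) : 0 < v < 1 -> is_derive (xm v) e (- (sinh e / rt v e)).
Proof.
  intros Hv. generalize (rt_pos v e (proj1 Hv)) (rt_lt_cosh v e Hv). intros.
  replace (- (sinh e / rt v e)) with ((sinh e - sinh e * cosh e / rt v e) / (cosh e - rt v e))
    by (field; lra).
  apply (is_derive_ln_comp (fun e => cosh e - rt v e)); [lra|].
  apply (is_derive_minus (V := R_NormedModule)); [apply is_derive_cosh | now apply is_derive_rt_r].
Qed.

Lemma continuity_2d_rt (v e : R) : continuity_2d_pt rt v e.
Proof.
  apply (continuity_2d_pt_comp1 sqrt (fun v e => v + sinh e ^ 2)).
  - apply continuous_sqrt.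
  - apply continuity_2d_pt_plus; [apply continuity_2d_pt_id1|].
    apply (continuity_2d_pt_comp1 (fun e => sinh e ^ 2) (fun v e => e)).
    + apply (ex_derive_continuous (V := R_NormedModule)). auto_derive. auto.
    + apply continuity_2d_pt_id2.
Qed.

Lemma continuous_ln (x : R) : 0 < x -> continuous ln x.
Proof. intros Hx. apply (ex_derive_continuous (V := R_NormedModule)). auto_derive. auto. Qed.

Lemma continuity_2d_snd (f : R -> R) (v e : R) :
  continuous f e -> continuity_2d_pt (fun v e => f e) v e.
Proof.
  intros Hf. apply (continuity_2d_pt_comp1 f (fun v e => e)); auto. apply continuity_2d_pt_id2.
Qed.

Lemma continuity_2d_fst (f : R -> R) (v e : R) :
  continuous f v -> continuity_2d_pt (fun v e => f v) v e.
Proof.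
  intros Hf. apply (continuity_2d_pt_comp1 f (fun v e => v)); auto. apply continuity_2d_pt_id1.
Qed.

Lemma continuity_2d_xp (v e : R) : 0 < v -> continuity_2d_pt xp v e.
Proof.
  intros Hv. apply (continuity_2d_pt_comp1 ln (fun v e => cosh e + rt v e)).
  - apply continuous_ln. generalize (rt_pos v e Hv) (cosh_ge_1 e). lra.
  - apply continuity_2d_pt_plus; [|apply continuity_2d_rt].
    apply continuity_2d_snd, continuous_cosh.
Qed.

Lemma continuity_2d_xm (v e : R) : 0 < v < 1 -> continuity_2d_pt xm v e.
Proof.
  intros Hv. apply (continuity_2d_pt_comp1 ln (fun v e => cosh e - rt v e)).
  - apply continuous_ln. generalize (rt_lt_cosh v e Hv). lra.
  - apply continuity_2d_pt_minus; [|apply continuity_2d_rt].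
    apply continuity_2d_snd, continuous_cosh.
Qed.

Lemma continuity_2d_yy (x e : R) : continuity_2d_pt yy x e.
Proof.
  apply continuity_2d_pt_minus.
  - apply (continuity_2d_fst (fun x => 1 + exp x ^ 2)).
    apply (ex_derive_continuous (V := R_NormedModule)). auto_derive. auto.
  - apply continuity_2d_pt_mult.
    + apply (continuity_2d_fst (fun x => 2 * exp x)).
      apply (ex_derive_continuous (V := R_NormedModule)). auto_derive. auto.
    + apply continuity_2d_snd, continuous_cosh.
Qed.

(** The endpoints move with speeds [+- exp (- x) / (2 rt)] in [v] and [+- sinh e / rt] in [e]. The
    common factor [1 / rt] and the opposite signs make this quotient appear in both derivatives of
    [outer]. *)
Definition folded (G : R -> R) (v e : R) : R := (G (xp v e) - G (xm v e)) / rt v e.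

Lemma continuity_2d_folded (G : R -> R) (v e : R) :
  (forall x, continuous G x) -> 0 < v < 1 -> continuity_2d_pt (folded G) v e.
Proof.
  intros HG Hv. apply continuity_2d_pt_mult.
  - apply continuity_2d_pt_minus.
    + apply continuity_2d_pt_comp1; [apply HG | apply continuity_2d_xp; lra].
    + apply continuity_2d_pt_comp1; [apply HG | now apply continuity_2d_xm].
  - apply continuity_2d_pt_inv; [apply continuity_2d_rt|].
    generalize (rt_pos v e (proj1 Hv)). lra.
Qed.

(* The slice at fixed [e] of the integral over [yy x e > v], with sign [+] above [xp v e]
   and [-] below [xm v e]. *)
Definition outer (H : R) (G Phi : R -> R) (v e : R) : R :=
  RInt (fun x => G x * Phi (yy x e)) (xp v e) H
  - RInt (fun x => G x * Phi (yy x e)) (- H) (xm v e).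

Lemma continuity_2d_weighted (G Phi : R -> R) (x e : R) :
  (forall x, continuous G x) -> (forall y, continuous Phi y) ->
  continuity_2d_pt (fun x e => G x * Phi (yy x e)) x e.
Proof.
  intros HG HP. apply continuity_2d_pt_mult.
  - apply continuity_2d_fst, HG.
  - apply continuity_2d_pt_comp1; [apply HP | apply continuity_2d_yy].
Qed.

Lemma continuity_2d_pt_swap (K : R -> R -> R) (x e : R) :
  continuity_2d_pt K x e -> continuity_2d_pt (fun e x => K x e) e x.
Proof. intros HK eps. destruct (HK eps) as [d Hd]. exists d. intros; now apply Hd. Qed.

Lemma continuous_weighted (G Phi : R -> R) (x e : R) :
  (forall x, continuous G x) -> (forall y, continuous Phi y) ->
  continuous (fun x => G x * Phi (yy x e)) x.
Proof.
  intros HG HP.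
  apply (continuity_2d_section_l (fun x e => G x * Phi (yy x e))).
  now apply continuity_2d_weighted.
Qed.

Lemma continuous_outer (H : R) (G Phi : R -> R) (v e : R) :
  (forall x, continuous G x) -> (forall y, continuous Phi y) -> 0 < v < 1 ->
  continuous (outer H G Phi v) e.
Proof.
  intros HG HP Hv.
  assert (HK : forall e x, continuity_2d_pt (fun e x => G x * Phi (yy x e)) e x).
  { intros. apply (continuity_2d_pt_swap (fun x e => G x * Phi (yy x e))).
    now apply continuity_2d_weighted. }
  apply (continuous_minus (V := R_NormedModule)).
  - apply (continuous_RInt_param (fun e x => G x * Phi (yy x e)) (xp v) (fun _ => H)); auto.
    + intros u. apply continuity_2d_section_r, continuity_2d_xp. lra.
    + intros; apply continuous_const.
  - apply (continuous_RInt_param (fun e x => G x * Phi (yy x e)) (fun _ => - H) (xm v)); auto.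
    + intros; apply continuous_const.
    + intros u. now apply continuity_2d_section_r, continuity_2d_xm.
Qed.

Lemma is_derive_RInt_lower (f g : R -> R) (x b l : R) :
  (forall t, continuous f t) -> is_derive g x l ->
  is_derive (fun x => RInt f (g x) b) x (- (l * f (g x))).
Proof.
  intros Hf Hg.
  apply (is_derive_ext (fun x => - RInt f b (g x))).
  { intros t. apply (opp_RInt_swap (V := R_CompleteNormedModule)).
    now apply ex_RInt_continuous_everywhere. }
  apply (is_derive_opp (V := R_NormedModule)).
  apply (is_derive_comp (V := R_NormedModule) (fun y => RInt f b y) g); auto.
  apply (is_derive_RInt (V := R_NormedModule) f _ b); auto.
  apply filter_forall. intros y. apply (RInt_correct (V := R_CompleteNormedModule)).
  now apply ex_RInt_continuous_everywhere.
Qed.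

Lemma is_derive_RInt_upper (f g : R -> R) (x b l : R) :
  (forall t, continuous f t) -> is_derive g x l ->
  is_derive (fun x => RInt f b (g x)) x (l * f (g x)).
Proof.
  intros Hf Hg.
  apply (is_derive_comp (V := R_NormedModule) (fun y => RInt f b y) g); auto.
  apply (is_derive_RInt (V := R_NormedModule) f _ b); auto.
  apply filter_forall. intros y. apply (RInt_correct (V := R_CompleteNormedModule)).
  now apply ex_RInt_continuous_everywhere.
Qed.

(** The integrand is independent of [v], so only the endpoints contribute. At both of them [yy]
    equals [v], hence [Phi v] factors out of the difference. *)
Lemma is_derive_outer_l (H : R) (G Phi : R -> R) (v e : R) :
  (forall x, continuous G x) -> (forall y, continuous Phi y) -> 0 < v < 1 ->
  is_derive (fun v => outer H G Phi v e) v
    (- / 2 * Phi v * folded (fun x => G x * exp (- x)) v e).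
Proof.
  intros HG HP Hv. unfold outer.
  replace (- / 2 * Phi v * folded (fun x => G x * exp (- x)) v e) with
    (- (exp (- xp v e) / (2 * rt v e) * (G (xp v e) * Phi (yy (xp v e) e)))
     - (- (exp (- xm v e) / (2 * rt v e)) * (G (xm v e) * Phi (yy (xm v e) e)))).
  2:{ rewrite yy_xp, yy_xm by lra. unfold folded. generalize (rt_pos v e (proj1 Hv)). intros.
      field. lra. }
  apply (is_derive_minus (V := R_NormedModule)).
  - apply (is_derive_RInt_lower (fun x => G x * Phi (yy x e)) (fun v => xp v e)).
    + intros. now apply continuous_weighted.
    + apply is_derive_xp_l; lra.
  - apply (is_derive_RInt_upper (fun x => G x * Phi (yy x e)) (fun v => xm v e)).
    + intros. now apply continuous_weighted.
    + now apply is_derive_xm_l.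
Qed.

Lemma is_derive_RInt_outer (H : R) (G Phi w : R -> R) (v : R) :
  0 <= H -> (forall x, continuous G x) -> (forall y, continuous Phi y) ->
  (forall e, continuous w e) -> 0 < v < 1 ->
  is_derive (fun v => RInt (fun e => w e * outer H G Phi v e) 0 H) v
    (- / 2 * Phi v * RInt (fun e => w e * folded (fun x => G x * exp (- x)) v e) 0 H).
Proof.
  intros HH HG HP Hw Hv.
  assert (HG1 : forall x, continuous (fun x => G x * exp (- x)) x).
  { intros x. apply (continuous_mult (K := R_AbsRing)); auto.
    apply (ex_derive_continuous (V := R_NormedModule)). auto_derive. auto. }
  replace (- / 2 * Phi v * RInt (fun e => w e * folded (fun x => G x * exp (- x)) v e) 0 H) with
    (RInt (fun e => w e * (- / 2 * Phi v * folded (fun x => G x * exp (- x)) v e)) 0 H).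
  2:{ rewrite <- (RInt_scal (V := R_CompleteNormedModule)
        (fun e => w e * folded (fun x => G x * exp (- x)) v e)).
      - apply RInt_ext. intros e _. unfold scal; simpl; unfold mult; simpl. ring.
      - apply ex_RInt_continuous_everywhere. intros e.
        apply (continuous_mult (K := R_AbsRing)); auto.
        now apply continuity_2d_section_r, continuity_2d_folded. }
  apply (is_derive_RInt_param_open (fun v e => w e * outer H G Phi v e)
    (fun v e => w e * (- / 2 * Phi v * folded (fun x => G x * exp (- x)) v e)) 0 1); auto.
  - intros y t Hy. apply is_derive_scal.
    now apply is_derive_outer_l.
  - intros y t Hy. apply (continuous_mult (K := R_AbsRing)); auto. now apply continuous_outer.
  - intros y t Hy. apply continuity_2d_pt_mult; [now apply continuity_2d_snd|].
    apply continuity_2d_pt_mult; [|now apply continuity_2d_folded].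
    apply (continuity_2d_fst (fun v => - / 2 * Phi v)).
    apply (continuous_mult (K := R_AbsRing)); auto. apply continuous_const.
Qed.

Lemma RInt_zero_fun (f : R -> R) (a b : R) :
  (forall x, Rmin a b < x < Rmax a b -> f x = 0) -> RInt f a b = 0.
Proof.
  intros Hf. rewrite (RInt_ext _ (fun _ => 0)); auto.
  rewrite RInt_const. unfold scal; simpl; unfold mult; simpl. ring.
Qed.

Lemma sinh_le_rt (v e : R) : 0 < v -> 0 <= e -> sinh e <= rt v e.
Proof.
  intros Hv He. unfold rt. rewrite <- (sqrt_pow2 (sinh e)) at 1 by now apply sinh_nonneg.
  apply sqrt_le_1_alt. lra.
Qed.

(** Since [exp e = cosh e + sinh e], the bound [e] is the larger solution for [v = 0], and [rt] is
    at least [sinh]. For [e = H] this places the slice beyond the support of [G]. *)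
Lemma xp_ge (v e : R) : 0 < v -> 0 <= e -> e <= xp v e.
Proof.
  intros Hv He. rewrite <- (ln_exp e) at 1. apply ln_le; [apply exp_pos|].
  replace (exp e) with (cosh e + sinh e) by (unfold cosh, sinh; lra).
  generalize (sinh_le_rt v e Hv He). lra.
Qed.

Lemma xm_le (v e : R) : 0 < v < 1 -> 0 <= e -> xm v e <= - e.
Proof.
  intros Hv He. rewrite <- (ln_exp (- e)). apply ln_le; [generalize (rt_lt_cosh v e Hv); lra|].
  replace (exp (- e)) with (cosh e - sinh e) by (unfold cosh, sinh; lra).
  generalize (sinh_le_rt v e (proj1 Hv) He). lra.
Qed.

(* Integration by parts in [e] turns [folded G * p * sinh] into [outer], whose derivative in
   [v] is again a [folded]. *)
Lemma fold_integral_descent (H : R) (G p p' : R -> R) :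
  0 <= H -> (forall x, continuous G x) ->
  (forall x, H <= x \/ x <= - H -> G x = 0) ->
  (forall e, is_derive p e (p' e)) -> (forall e, continuous p' e) -> p 0 = 0 ->
  (forall v, 0 < v < 1 -> RInt (fun e => p e * sinh e * folded G v e) 0 H = 0) ->
  forall v, 0 < v < 1 -> RInt (fun e => p' e * folded (fun x => G x * exp (- x)) v e) 0 H = 0.
Proof.
  intros HH HG Hsupp Hp Hp' Hp0 HZ v Hv.
  assert (H1 : forall y : R, continuous (fun _ : R => 1) y) by (intros; apply continuous_const).
  assert (HpC : forall e, continuous p e).
  { intros e. apply (ex_derive_continuous (V := R_NormedModule)). eexists; apply Hp. }
  assert (HR : forall u, 0 < u < 1 -> forall e,
    is_derive (outer H G (fun _ => 1) u) e (- (sinh e * folded G u e))).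
  { intros u Hu e. unfold outer.
    replace (- (sinh e * folded G u e)) with
      (- (sinh e / rt u e * G (xp u e)) - (- (sinh e / rt u e)) * G (xm u e))
      by (unfold folded; generalize (rt_pos u e (proj1 Hu)); intros; field; lra).
    apply (is_derive_ext (fun e => RInt G (xp u e) H - RInt G (- H) (xm u e))).
    { intros t. apply (f_equal2 Rminus); apply RInt_ext; intros; symmetry; apply Rmult_1_r. }
    apply (is_derive_minus (V := R_NormedModule)).
    - apply (is_derive_RInt_lower G (xp u)); auto. apply is_derive_xp_r; lra.
    - apply (is_derive_RInt_upper G (xm u)); auto. now apply is_derive_xm_r. }
  (* Integration by parts against [p]. The boundary term at [0] vanishes because [p 0 = 0], and the
     one at [H] because both slices lie outside the support of [G]. *)
  assert (HI : forall u, 0 < u < 1 ->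
    RInt (fun e => p' e * outer H G (fun _ => 1) u e) 0 H = 0).
  { intros u Hu.
    assert (Hend : outer H G (fun _ => 1) u H = 0).
    { unfold outer. rewrite !RInt_zero_fun; [ring| |]; intros x Hx.
      - generalize (xm_le u H Hu HH). intros. rewrite Rmin_right, Rmax_left in Hx by lra.
        rewrite Hsupp by lra. ring.
      - generalize (xp_ge u H (proj1 Hu) HH). intros. rewrite Rmin_right, Rmax_left in Hx by lra.
        rewrite Hsupp by lra. ring. }
    assert (Hfold : forall e, continuous (fun e => p e * sinh e * folded G u e) e).
    { intros e. apply (continuous_mult (K := R_AbsRing)).
      - apply (continuous_mult (K := R_AbsRing)); [apply HpC | apply continuous_sinh].
      - now apply continuity_2d_section_r, continuity_2d_folded. }
    assert (HO : forall e, continuous (fun e => p' e * outer H G (fun _ => 1) u e) e).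
    { intros e. apply (continuous_mult (K := R_AbsRing)); auto. now apply continuous_outer. }
    assert (E : is_RInt (fun e => p' e * outer H G (fun _ => 1) u e
                           - p e * sinh e * folded G u e) 0 H
      (minus (p H * outer H G (fun _ => 1) u H) (p 0 * outer H G (fun _ => 1) u 0))).
    { apply (is_RInt_derive (V := R_CompleteNormedModule)
              (fun e => p e * outer H G (fun _ => 1) u e)).
      - intros e _.
        replace (p' e * outer H G (fun _ => 1) u e - p e * sinh e * folded G u e) with
          (p' e * outer H G (fun _ => 1) u e + p e * - (sinh e * folded G u e)) by ring.
        apply (is_derive_mult (K := R_AbsRing)); auto. apply Rmult_comm.
      - intros e _. apply (continuous_minus (V := R_NormedModule)); auto. }
    generalize (is_RInt_unique (V := R_CompleteNormedModule) _ _ _ _ E). clear E. intros E.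
    rewrite (RInt_minus (V := R_CompleteNormedModule)) in E
      by now apply ex_RInt_continuous_everywhere.
    rewrite HZ, Hend, Hp0 in E by auto.
    unfold minus, plus, opp in E; simpl in E. lra. }
  (* [HI] holds on the whole interval, so it may be differentiated in [v]; with [Phi = 1] the
     derivative is [- / 2] times the integral sought. *)
  assert (HD := is_derive_RInt_outer H G (fun _ => 1) p' v HH HG H1 Hp' Hv).
  assert (H0 : is_derive (fun v => RInt (fun e => p' e * outer H G (fun _ => 1) v e) 0 H) v 0).
  { apply (is_derive_ext_loc (fun _ => 0)); [|apply (is_derive_const (V := R_NormedModule))].
    apply (locally_interval _ v 0 1); simpl; try tauto.
    intros y H2 H3. symmetry. now apply HI. }
  apply is_derive_unique in HD. apply is_derive_unique in H0.
  rewrite HD in H0. lra.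
Qed.

(** * From the sinh weight to the Chebyshev weight *)

(* [ring] does not see through the canonical-structure carrier that [RInt_ext] leaves. *)
Ltac real_eq := match goal with |- ?a = ?b => change (@eq R a b) end.

(** This is [t^(2 - m) h(t)] at [t = exp x]. Each derivative in [v] costs a factor [exp (- x)],
    hence raises [m] by one; [m = 1] is the weight [t h(t)] in which the hypothesis appears. *)
Definition logw (h : R -> R) (m : nat) (x : R) : R := exp ((2 - INR m) * x) * h (exp x).

Lemma logw_succ (h : R -> R) (m : nat) (x : R) : logw h m x * exp (- x) = logw h (S m) x.
Proof.
  unfold logw. rewrite S_INR.
  replace ((2 - (INR m + 1)) * x) with ((2 - INR m) * x + - x) by ring.
  rewrite exp_plus. ring.
Qed.

Lemma continuous_logw (h : R -> R) (m : nat) (x : R) :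
  (forall t, continuous h t) -> continuous (logw h m) x.
Proof.
  intros Hh. apply (continuous_mult (K := R_AbsRing)).
  - apply (ex_derive_continuous (V := R_NormedModule)). auto_derive. auto.
  - apply (continuous_comp exp h); auto.
    apply (ex_derive_continuous (V := R_NormedModule)). auto_derive. auto.
Qed.

Lemma folded_ext (F G : R -> R) (v e : R) : (forall x, F x = G x) -> folded F v e = folded G v e.
Proof. intros E. unfold folded. now rewrite !E. Qed.

Lemma continuous_gegen_cosh (a : R) (m : nat) (e : R) :
  continuous (fun e => fst (gegen a m) (cosh e)) e.
Proof.
  apply (continuous_comp cosh (fst (gegen a m))); [apply continuous_cosh|].
  apply (ex_derive_continuous (V := R_NormedModule)). eexists; exact (proj1 (is_derive_gegen a m (cosh e))).
Qed.

Lemma continuous_sinh_pow (k : nat) (e : R) : continuous (fun e => sinh e ^ k) e.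
Proof. apply (ex_derive_continuous (V := R_NormedModule)). auto_derive. auto. Qed.

(** The recursion of [gegen] is read off from this derivative: the factor [2 n - 1] there is
    [2 k + 1], the exponent of [sinh], and [x^2 - 1] is [sinh^2]. *)
Lemma is_derive_sinh_pow_gegen (alpha k m : nat) (e : R) :
  (alpha - m = S k)%nat ->
  is_derive (fun e => sinh e ^ (2 * k + 1) * fst (gegen (INR alpha) m) (cosh e)) e
    (sinh e ^ (2 * k) * fst (gegen (INR alpha) (S m)) (cosh e)).
Proof.
  intros Hk. destruct (is_derive_gegen (INR alpha) m (cosh e)) as [Hq _].
  assert (Hn : INR alpha - INR m = INR k + 1).
  { rewrite <- S_INR, <- Hk, minus_INR by lia. ring. }
  cbn [gegen fst]. rewrite Hn.
  set (q := fst (gegen (INR alpha) m)) in *. set (q1 := snd (gegen (INR alpha) m)) in *.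
  assert (H1 : is_derive (fun e => sinh e ^ (2 * k + 1)) e
                 ((2 * INR k + 1) * cosh e * sinh e ^ (2 * k))).
  { auto_derive; auto. replace (Init.Nat.pred (k + (k + 0) + 1)) with (2 * k)%nat by lia.
    replace (k + (k + 0) + 1)%nat with (S (2 * k)) by lia. rewrite S_INR, mult_INR.
    change (INR 2) with 2. ring. }
  assert (H2 : is_derive (fun e => q (cosh e)) e (sinh e * q1 (cosh e))).
  { apply (is_derive_comp (V := R_NormedModule) q cosh); [exact Hq | apply is_derive_cosh]. }
  replace (sinh e ^ (2 * k) * _) with
    ((2 * INR k + 1) * cosh e * sinh e ^ (2 * k) * q (cosh e)
     + sinh e ^ (2 * k + 1) * (sinh e * q1 (cosh e))).
  - exact (is_derive_mult (K := R_AbsRing) _ _ _ _ _ H1 H2 Rmult_comm).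
  - rewrite (pow_add _ (2 * k) 1), cosh_sinh_sq. ring.
Qed.

Lemma gegen_fold_integral (alpha : nat) (h : R -> R) (H : R) :
  0 <= H -> (forall t, continuous h t) ->
  (forall x, H <= x \/ x <= - H -> h (exp x) = 0) ->
  (forall v, 0 < v < 1 ->
     RInt (fun e => sinh e ^ (2 * alpha) * folded (logw h 1) v e) 0 H = 0) ->
  forall m v, (m <= alpha)%nat -> 0 < v < 1 ->
    RInt (fun e => sinh e ^ (2 * (alpha - m)) * fst (gegen (INR alpha) m) (cosh e)
                   * folded (logw h (S m)) v e) 0 H = 0.
Proof.
  intros HH Hh Hs H0. induction m as [|m IH]; intros v Hm Hv.
  - etransitivity; [|apply (H0 v Hv)]. apply RInt_ext. intros e _.
    real_eq. cbn [gegen fst]. rewrite Nat.sub_0_r. ring.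
  - destruct (alpha - m)%nat as [|k] eqn:Hk; [lia|].
    replace (alpha - S m)%nat with k by lia.
    (* The function [p] is the current weight divided by [sinh]. As [alpha - m = S k], it still has
       the positive exponent [2 k + 1], so it vanishes at [0]. *)
    etransitivity; [|apply (fold_integral_descent H (logw h (S m))
      (fun e => sinh e ^ (2 * k + 1) * fst (gegen (INR alpha) m) (cosh e))
      (fun e => sinh e ^ (2 * k) * fst (gegen (INR alpha) (S m)) (cosh e)) HH) with (v := v); auto].
    + apply RInt_ext. intros e _. f_equal. apply folded_ext. intros x. symmetry. apply logw_succ.
    + intros x. now apply continuous_logw.
    + intros x Hx. unfold logw. rewrite Hs by auto. ring.
    + intros e. now apply is_derive_sinh_pow_gegen.
    + intros e. apply (continuous_mult (K := R_AbsRing)).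
      * apply continuous_sinh_pow.
      * apply continuous_gegen_cosh.
    + rewrite sinh_0, pow_add. simpl. ring.
    + intros u Hu. etransitivity; [|apply (IH u); [lia | auto]]. apply RInt_ext. intros e _. real_eq.
      replace (2 * S k)%nat with (2 * k + 1 + 1)%nat by lia.
      rewrite (pow_add _ (2 * k + 1) 1). ring.
Qed.

(** * Estimates for the limit [v -> 0] *)

Lemma bounded_continuous (f : R -> R) (a b : R) :
  (forall x, continuous f x) -> exists M, 0 <= M /\ forall x, a <= x <= b -> Rabs (f x) <= M.
Proof.
  intros Hf.
  destruct (bounded_continuity (V := R_NormedModule) f a b) as [M HM].
  { intros x _. apply Hf. }
  exists (Rmax 0 M). split; [apply Rmax_l|]. intros x Hx.
  apply Rle_trans with M; [left; now apply HM | apply Rmax_r].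
Qed.

Lemma cosh_le_exp (e H : R) : 0 <= e <= H -> cosh e <= exp H.
Proof.
  intros He. unfold cosh.
  assert (exp e <= exp H) by (destruct (Rle_lt_or_eq_dec e H) as [h | ->]; try lra; left; now apply exp_increasing).
  assert (exp (- e) <= exp e).
  { destruct (Req_dec e 0) as [-> | h]; [rewrite Ropp_0; lra|]. left; apply exp_increasing; lra. }
  lra.
Qed.

Lemma weighted_bound (H : R) (G Phi : R -> R) :
  (forall x, continuous G x) -> (forall y, continuous Phi y) ->
  (forall x, H <= x \/ x <= - H -> G x = 0) ->
  exists C, 0 <= C /\ forall x e, 0 <= e <= H -> Rabs (G x * Phi (yy x e)) <= C.
Proof.
  intros HG HP Hs.
  destruct (bounded_continuous G (- H) H HG) as [M [HM HM']].
  (* A crude bound for [yy] on the box [|x| <= H], [0 <= e <= H], from [cosh e <= exp H]; for other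
     [x] the factor [G] is zero. *)
  set (Y := 1 + exp H ^ 2 + 2 * exp H * exp H).
  destruct (bounded_continuous Phi (- Y) Y HP) as [N [HN HN']].
  exists (M * N). split; [now apply Rmult_le_pos|]. intros x e He.
  rewrite Rabs_mult.
  destruct (Rle_dec H x) as [h | h].
  { rewrite Hs by auto. rewrite Rabs_R0, Rmult_0_l. now apply Rmult_le_pos. }
  destruct (Rle_dec x (- H)) as [h' | h'].
  { rewrite Hs by auto. rewrite Rabs_R0, Rmult_0_l. now apply Rmult_le_pos. }
  apply Rmult_le_compat; try apply Rabs_pos.
  - apply HM'. lra.
  - apply HN'. unfold yy, Y.
    assert (Hx : exp x < exp H) by (apply exp_increasing; lra).
    generalize (exp_pos x) (cosh_le_exp e H He) (cosh_ge_1 e). intros.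
    assert (0 <= exp x * cosh e) by nra.
    assert (exp x * cosh e <= exp H * exp H) by (apply Rmult_le_compat; lra).
    nra.
Qed.

Lemma abs_RInt_le_bound (f : R -> R) (a b C : R) :
  (forall x, continuous f x) -> (forall x, Rabs (f x) <= C) ->
  Rabs (RInt f a b) <= C * Rabs (b - a).
Proof.
  intros Hf HC. rewrite Rmult_comm.
  apply (norm_RInt_le_const_abs (V := R_NormedModule) f a b (RInt f a b) C).
  - intros x _. apply HC.
  - apply (RInt_correct (V := R_CompleteNormedModule)).
    now apply ex_RInt_continuous_everywhere.
Qed.

Lemma rt_le_add_sqrt (v e : R) : 0 < v -> 0 <= e -> rt v e <= sinh e + sqrt v.
Proof.
  intros Hv He. generalize (sinh_nonneg e He) (sqrt_pos v). intros.
  unfold rt. rewrite <- (sqrt_pow2 (sinh e + sqrt v)) by lra.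
  apply sqrt_le_1_alt.
  assert (E : sqrt v * sqrt v = v) by (apply sqrt_sqrt; lra). nra.
Qed.

(** For [e >= 0], [exp (e + sqrt v) >= exp e + sqrt v >= cosh e + rt v e]. The order [sqrt v] is the
    true one at [e = 0], where [exp (xp v 0) = 1 + sqrt v]. *)
Lemma xp_upper (v e : R) : 0 < v -> 0 <= e -> xp v e <= e + sqrt v.
Proof.
  intros Hv He. rewrite <- (ln_exp (e + sqrt v)).
  apply ln_le; [generalize (rt_pos v e Hv) (cosh_ge_1 e); lra|].
  rewrite exp_plus.
  assert (E : exp e = cosh e + sinh e) by (unfold cosh, sinh; lra).
  generalize (rt_le_add_sqrt v e Hv He) (exp_ineq1_le (sqrt v)) (sqrt_pos v)
    (cosh_ge_1 e) (sinh_nonneg e He). rewrite E. nra.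
Qed.

(** From the bound on [xp] and [xp + xm = ln (1 - v)]; the term [2 v] comes from
    [ln (1 - v) >= - 2 v], valid for [v <= 1 / 2]. *)
Lemma xm_lower (v e : R) : 0 < v <= 1 / 2 -> 0 <= e -> - e - sqrt v - 2 * v <= xm v e.
Proof.
  intros Hv He. generalize (xp_add_xm v e ltac:(lra)) (xp_upper v e (proj1 Hv) He).
  assert (Hl : - (2 * v) <= ln (1 - v)).
  { rewrite <- (ln_exp (- (2 * v))). apply ln_le; [apply exp_pos|].
    rewrite exp_Ropp.
    generalize (exp_ineq1_le (2 * v)). intros.
    apply Rmult_le_reg_l with (exp (2 * v)); [apply exp_pos|].
    rewrite Rinv_r by (generalize (exp_pos (2 * v)); lra). nra. }
  lra.
Qed.

(** The value of [outer] at [v = 0] for [e >= 0], where the two solutions are [e] and [- e]. It is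
    separate because the facts about [xp] and [xm] require [0 < v]. *)
Definition outer0 (H : R) (G Phi : R -> R) (e : R) : R :=
  RInt (fun x => G x * Phi (yy x e)) e H - RInt (fun x => G x * Phi (yy x e)) (- H) (- e).

Lemma continuous_outer0 (H : R) (G Phi : R -> R) (e : R) :
  (forall x, continuous G x) -> (forall y, continuous Phi y) ->
  continuous (outer0 H G Phi) e.
Proof.
  intros HG HP.
  assert (HK : forall e x, continuity_2d_pt (fun e x => G x * Phi (yy x e)) e x).
  { intros. apply (continuity_2d_pt_swap (fun x e => G x * Phi (yy x e))).
    now apply continuity_2d_weighted. }
  apply (continuous_minus (V := R_NormedModule)).
  - apply (continuous_RInt_param (fun e x => G x * Phi (yy x e)) (fun e => e) (fun _ => H)); auto.
    + intros; apply continuous_id.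
    + intros; apply continuous_const.
  - apply (continuous_RInt_param (fun e x => G x * Phi (yy x e)) (fun _ => - H) (fun e => - e)); auto.
    + intros; apply continuous_const.
    + intros u. apply (continuous_opp (V := R_NormedModule)), continuous_id.
Qed.

Lemma outer_sub_outer0 (H C : R) (G Phi : R -> R) (v e : R) :
  (forall x, continuous G x) -> (forall y, continuous Phi y) ->
  0 < v <= 1 / 2 -> 0 <= e -> (forall x, Rabs (G x * Phi (yy x e)) <= C) ->
  Rabs (outer H G Phi v e - outer0 H G Phi e) <= C * (2 * sqrt v + 2 * v).
Proof.
  intros HG HP Hv He HC.
  set (F := fun x => G x * Phi (yy x e)).
  assert (HF : forall x, continuous F x) by (intros; now apply continuous_weighted).
  assert (Hex : forall a b, ex_RInt F a b) by (intros; now apply ex_RInt_continuous_everywhere).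
  assert (E : outer H G Phi v e - outer0 H G Phi e
              = RInt F (xp v e) e + RInt F (xm v e) (- e)).
  { unfold outer, outer0. fold F.
    rewrite <- (RInt_Chasles (V := R_CompleteNormedModule) F (xp v e) e H) by auto.
    rewrite <- (RInt_Chasles (V := R_CompleteNormedModule) F (- H) (xm v e) (- e)) by auto.
    unfold plus; simpl. ring. }
  rewrite E.
  assert (C0 : 0 <= C) by (eapply Rle_trans; [apply Rabs_pos | apply (HC 0)]).
  eapply Rle_trans; [apply Rabs_triang|].
  eapply Rle_trans; [apply Rplus_le_compat; apply abs_RInt_le_bound; eauto|].
  rewrite <- Rmult_plus_distr_l. apply Rmult_le_compat_l; auto.
  generalize (xp_ge v e (proj1 Hv) He) (xp_upper v e (proj1 Hv) He)
    (xm_le v e ltac:(lra) He) (xm_lower v e Hv He). intros.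
  rewrite Rabs_left1, Rabs_pos_eq; lra.
Qed.

(** The integral [I v] has derivative zero on [(0, 1)], vanishes at one point and tends to the
    integral of [outer0]. The condition [b < ln 2] provides the point: as [v] approaches [1],
    [exp (xp v e)] is bounded below by numbers tending to [2], while [xm] falls below [- H]. *)
Lemma outer0_integral_zero (H b : R) (G Phi w : R -> R) :
  0 < H -> b <= H -> b < ln 2 ->
  (forall x, continuous G x) -> (forall y, continuous Phi y) -> (forall e, continuous w e) ->
  (forall x, b <= x \/ x <= - H -> G x = 0) ->
  (forall v, 0 < v < 1 -> RInt (fun e => w e * folded (fun x => G x * exp (- x)) v e) 0 H = 0) ->
  RInt (fun e => w e * outer0 H G Phi e) 0 H = 0.
Proof.
  intros HH HbH Hb HG HP Hw Hs HZ.
  set (I := fun v => RInt (fun e => w e * outer H G Phi v e) 0 H).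
  assert (HI' : forall v, 0 < v < 1 -> is_derive I v 0).
  { intros v Hv.
    replace 0 with (- / 2 * Phi v * RInt (fun e => w e * folded (fun x => G x * exp (- x)) v e) 0 H)
      by (rewrite HZ by auto; ring).
    exact (is_derive_RInt_outer H G Phi w v (Rlt_le _ _ HH) HG HP Hw Hv). }
  assert (H1 : exists v1, 0 < v1 < 1 /\ I v1 = 0).
  (* The first entry gives [rt >= exp b - 1], hence [xp >= b] since [cosh e >= 1]. The second gives
     [ln (1 - v1) <= - H], hence [xm <= - H] since [xp >= 0]. *)
  { set (v1 := Rmax ((exp b - 1) ^ 2) (1 - exp (- H))).
    assert (Heb : exp b < 2).
    { rewrite <- (exp_ln 2) by lra. now apply exp_increasing. }
    assert (HeH : 0 < exp (- H) < 1).
    { split; [apply exp_pos|]. rewrite <- exp_0. apply exp_increasing. lra. }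
    assert (Hv1 : 0 < v1 < 1).
    { generalize (exp_pos b). unfold v1. intros. split.
      - apply Rlt_le_trans with (1 - exp (- H)); [lra | apply Rmax_r].
      - apply Rmax_lub_lt; nra. }
    exists v1. split; auto. unfold I. apply RInt_zero_fun.
    rewrite Rmin_left, Rmax_right by lra. intros e He.
    assert (Hxp : b <= xp v1 e).
    { rewrite <- (ln_exp b). apply ln_le; [apply exp_pos|].
      assert (Hr : exp b - 1 <= rt v1 e).
      { destruct (Rle_dec (exp b - 1) 0) as [h | h].
        - generalize (rt_pos v1 e (proj1 Hv1)). lra.
        - unfold rt. rewrite <- (sqrt_pow2 (exp b - 1)) by lra. apply sqrt_le_1_alt.
          generalize (pow2_ge_0 (sinh e)) (Rmax_l ((exp b - 1) ^ 2) (1 - exp (- H))).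
          fold v1. lra. }
      generalize (cosh_ge_1 e). lra. }
    assert (Hxm : xm v1 e <= - H).
    { generalize (xp_add_xm v1 e Hv1) (xp_ge v1 e (proj1 Hv1) ltac:(lra)). intros.
      assert (ln (1 - v1) <= - H); [|lra].
      rewrite <- (ln_exp (- H)). apply ln_le; [lra|].
      generalize (Rmax_r ((exp b - 1) ^ 2) (1 - exp (- H))). fold v1. lra. }
    unfold outer. rewrite !RInt_zero_fun; [ring| |]; intros x Hx.
    - rewrite Rmin_right, Rmax_left in Hx by lra. rewrite Hs by lra. ring.
    - assert (b < x).
      { apply Rle_lt_trans with (Rmin (xp v1 e) H); [now apply Rmin_glb | tauto]. }
      rewrite Hs by lra. ring. }
  destruct H1 as [v1 [Hv1 HIv1]].
  assert (HI : forall v, 0 < v < 1 -> I v = 0).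
  { intros v Hv. rewrite <- HIv1. now apply (is_derive_zero_constant I 0 1). }
  destruct (weighted_bound H G Phi HG HP) as [C [HC0 HC]].
  { intros x Hx. apply Hs. lra. }
  destruct (bounded_continuous w 0 H Hw) as [W [HW0 HW]].
  set (I0 := RInt (fun e => w e * outer0 H G Phi e) 0 H).
  assert (Hbd : forall v, 0 < v <= 1 / 2 -> Rabs I0 <= H * (W * (C * (2 * sqrt v + 2 * v)))).
  { intros v Hv.
    assert (Ho : forall e, continuous (fun e => w e * outer H G Phi v e) e).
    { intros e. apply (continuous_mult (K := R_AbsRing)); auto. apply continuous_outer; auto; lra. }
    assert (Ho0 : forall e, continuous (fun e => w e * outer0 H G Phi e) e).
    { intros e. apply (continuous_mult (K := R_AbsRing)); auto. now apply continuous_outer0. }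
    replace I0 with (- (I v - I0)) by (rewrite HI by lra; ring).
    rewrite Rabs_Ropp. unfold I, I0.
    rewrite <- (RInt_minus (V := R_CompleteNormedModule)) by now apply ex_RInt_continuous_everywhere.
    replace (H * (W * (C * (2 * sqrt v + 2 * v))))
      with ((H - 0) * (W * (C * (2 * sqrt v + 2 * v)))) by ring.
    apply (abs_RInt_le_const (fun e => minus (w e * outer H G Phi v e) (w e * outer0 H G Phi e))).
    - lra.
    - apply ex_RInt_continuous_everywhere. intros e.
      apply (continuous_minus (V := R_NormedModule)); auto.
    - intros e He.
      change (minus (w e * outer H G Phi v e) (w e * outer0 H G Phi e)) with
        (w e * outer H G Phi v e - w e * outer0 H G Phi e).
      rewrite <- Rmult_minus_distr_l, Rabs_mult.
      apply Rmult_le_compat; try apply Rabs_pos; auto.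
      apply outer_sub_outer0; auto. lra. }
  apply Rabs_eq_0, Rle_antisym; [|apply Rabs_pos].
  apply le_epsilon. intros eps Heps. rewrite Rplus_0_l.
  (* At [v = s^2] with [s <= 1 / 2] the factor [2 sqrt v + 2 v] is at most [4 s], so the bound
     becomes [D * s]. Dividing [eps] by [D + 1] covers [D = 0]. *)
  set (D := H * (W * (C * 4))).
  assert (HD : 0 <= D) by (unfold D; repeat apply Rmult_le_pos; lra).
  set (s := Rmin (1 / 2) (eps / (D + 1))).
  assert (Hq : 0 < eps / (D + 1)) by (apply Rdiv_lt_0_compat; lra).
  assert (Hs1 : 0 < s <= 1 / 2) by (split; [apply Rmin_glb_lt; lra | apply Rmin_l]).
  assert (Hs2 : s <= eps / (D + 1)) by apply Rmin_r.
  eapply Rle_trans; [apply (Hbd (s ^ 2)); nra|].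
  rewrite sqrt_pow2 by lra.
  apply Rle_trans with (D * s).
  - replace (D * s) with (H * (W * (C * (4 * s)))) by (unfold D; ring).
    repeat (apply Rmult_le_compat_l; [lra|]). nra.
  - apply Rle_trans with (D * (eps / (D + 1))); [now apply Rmult_le_compat_l|].
    apply Rmult_le_reg_r with (D + 1); [lra|]. field_simplify; [nra | lra].
Qed.

(** * The kernel integral [S], and Fubini's theorem for its pairing with [G] *)

Definition transmute (Phi w : R -> R) (x : R) : R := RInt (fun e => Phi (yy x e) * w e) 0 x.

Lemma continuous_transmute (Phi w : R -> R) (x : R) :
  (forall y, continuous Phi y) -> (forall e, continuous w e) ->
  continuous (transmute Phi w) x.
Proof.
  intros HP Hw.
  apply (continuous_RInt_param (fun x e => Phi (yy x e) * w e) (fun _ => 0) (fun x => x)).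
  - intros u e. apply continuity_2d_pt_mult.
    + apply continuity_2d_pt_comp1; [apply HP | apply continuity_2d_yy].
    + now apply continuity_2d_snd.
  - intros; apply continuous_const.
  - intros; apply continuous_id.
Qed.

Lemma RInt_reflect (f : R -> R) (a b : R) :
  (forall x, continuous f x) -> RInt f (- b) (- a) = RInt (fun x => f (- x)) a b.
Proof.
  intros Hf.
  rewrite <- (opp_RInt_swap (V := R_CompleteNormedModule)) by now apply ex_RInt_continuous_everywhere.
  replace (- a) with (-1 * a + 0) by ring. replace (- b) with (-1 * b + 0) by ring.
  rewrite <- (RInt_comp_lin (V := R_CompleteNormedModule))
    by now apply ex_RInt_continuous_everywhere.
  rewrite (RInt_scal (V := R_CompleteNormedModule) (fun y => f (-1 * y + 0))).
  - unfold opp, scal; simpl; unfold mult; simpl.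
    rewrite (RInt_ext (fun y => f (-1 * y + 0)) (fun x => f (- x))).
    + ring.
    + intros x _. f_equal. ring.
  - apply ex_RInt_continuous_everywhere. intros t.
    apply (continuous_comp (fun y => -1 * y + 0) f); auto.
    apply (ex_derive_continuous (V := R_NormedModule)). auto_derive. auto.
Qed.

Lemma cosh_opp (e : R) : cosh (- e) = cosh e.
Proof. unfold cosh. rewrite Ropp_involutive. lra. Qed.

(** Fubini on the triangles [0 <= e <= x] and [0 <= e <= - x]. For negative [x] the integral from
    [0] to [x] is minus the one over [[0, - x]], by evenness of [w] and [cosh]; this is why [outer]
    carries a minus sign below [xm]. *)
Lemma RInt_transmute (H : R) (G Phi w : R -> R) :
  0 < H -> (forall x, continuous G x) -> (forall y, continuous Phi y) ->
  (forall e, continuous w e) -> (forall e, w (- e) = w e) ->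
  RInt (fun x => G x * transmute Phi w x) (- H) H
  = RInt (fun e => w e * outer0 H G Phi e) 0 H.
Proof.
  intros HH HG HP Hw Heven.
  assert (HGc : forall x, continuous (fun x => G x * transmute Phi w x) x).
  { intros x. apply (continuous_mult (K := R_AbsRing)); auto. now apply continuous_transmute. }
  assert (Hopp : forall (f : R -> R), (forall x, continuous f x) ->
                  forall x, continuous (fun x => f (- x)) x).
  { intros f Hf x. apply (continuous_comp Ropp f); auto.
    apply (continuous_opp (V := R_NormedModule) (fun x => x)), continuous_id. }
  set (K := fun x e => (G x * Phi (yy x e)) * w e).
  set (K2 := fun x e => (G (- x) * Phi (yy (- x) e)) * w e).
  assert (HK : forall x e, continuity_2d_pt K x e).
  { intros x e. apply continuity_2d_pt_mult;
      [now apply continuity_2d_weighted | now apply continuity_2d_snd]. }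
  assert (HK2 : forall x e, continuity_2d_pt K2 x e).
  { intros x e. apply (continuity_2d_pt_comp2 K (fun x e => - x) (fun x e => e)); auto.
    - apply continuity_2d_pt_opp, continuity_2d_pt_id1.
    - apply continuity_2d_pt_id2. }
  assert (Hsec : forall x e, continuous (fun e => Phi (yy x e) * w e) e).
  { intros x e. apply (continuous_mult (K := R_AbsRing)); auto.
    apply (continuity_2d_section_r (fun x e => Phi (yy x e))).
    apply continuity_2d_pt_comp1; [apply HP | apply continuity_2d_yy]. }
  rewrite <- (RInt_Chasles (V := R_CompleteNormedModule) _ (- H) (- 0) H)
    by now apply ex_RInt_continuous_everywhere.
  rewrite RInt_reflect by auto. rewrite Ropp_0.
  rewrite (RInt_ext (fun x => G (- x) * transmute Phi w (- x)) (fun x => - RInt (K2 x) 0 x)).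
  2:{ intros x _. unfold transmute.
      rewrite <- (opp_RInt_swap (V := R_CompleteNormedModule))
        by now apply ex_RInt_continuous_everywhere.
      rewrite <- Ropp_0 at 1. rewrite RInt_reflect by auto.
      unfold K2. rewrite (RInt_ext (fun e => G (- x) * Phi (yy (- x) e) * w e)
         (fun e => scal (G (- x)) (Phi (yy (- x) e) * w e)))
        by (intros; unfold scal; simpl; unfold mult; simpl; ring).
      rewrite (RInt_scal (V := R_CompleteNormedModule)) by now apply ex_RInt_continuous_everywhere.
      rewrite (RInt_ext (fun e => Phi (yy (- x) (- e)) * w (- e)) (fun e => Phi (yy (- x) e) * w e)).
      - unfold opp, scal; simpl; unfold mult; simpl. ring.
      - intros e _. unfold yy. now rewrite cosh_opp, Heven. }
  rewrite (RInt_ext (fun x => G x * transmute Phi w x) (fun x => RInt (K x) 0 x)).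
  2:{ intros x _. unfold transmute, K.
      rewrite (RInt_ext (fun e => G x * Phi (yy x e) * w e)
         (fun e => scal (G x) (Phi (yy x e) * w e)))
        by (intros; unfold scal; simpl; unfold mult; simpl; ring).
      rewrite (RInt_scal (V := R_CompleteNormedModule)) by now apply ex_RInt_continuous_everywhere.
      reflexivity. }
  assert (Hdiag : forall (L : R -> R -> R), (forall x e, continuity_2d_pt L x e) ->
    forall x, continuous (fun x => RInt (L x) 0 x) x).
  { intros L HL x. apply (continuous_RInt_param L (fun _ => 0) (fun x => x)); auto.
    - intros; apply continuous_const.
    - intros; apply continuous_id. }
  rewrite (RInt_opp (V := R_CompleteNormedModule) (fun x => RInt (K2 x) 0 x))
    by (apply ex_RInt_continuous_everywhere; auto).
  rewrite !RInt_triangle_swap by auto.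
  assert (Hup : forall (L : R -> R -> R), (forall x e, continuity_2d_pt L x e) ->
    forall e, continuous (fun e => RInt (fun x => L x e) e H) e).
  { intros L HL e.
    apply (continuous_RInt_param (fun e x => L x e) (fun e => e) (fun _ => H)).
    - intros; now apply (continuity_2d_pt_swap L).
    - intros; apply continuous_id.
    - intros; apply continuous_const. }
  rewrite <- (RInt_opp (V := R_CompleteNormedModule))
    by (apply ex_RInt_continuous_everywhere; auto).
  rewrite <- (RInt_plus (V := R_CompleteNormedModule)).
  2:{ apply ex_RInt_continuous_everywhere. intros e.
      apply (continuous_opp (V := R_NormedModule)); auto. }
  2:{ apply ex_RInt_continuous_everywhere; auto. }
  apply RInt_ext. intros e _. unfold outer0.
  assert (HF : forall x, continuous (fun x => G x * Phi (yy x e)) x)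
    by (intros; now apply continuous_weighted).
  rewrite (RInt_reflect (fun x => G x * Phi (yy x e))) by auto.
  unfold K, K2.
  rewrite (RInt_ext (fun x => G x * Phi (yy x e) * w e)
     (fun x => scal (w e) (G x * Phi (yy x e))))
    by (intros; unfold scal; simpl; unfold mult; simpl; ring).
  rewrite (RInt_ext (fun x => G (- x) * Phi (yy (- x) e) * w e)
     (fun x => scal (w e) (G (- x) * Phi (yy (- x) e))))
    by (intros; unfold scal; simpl; unfold mult; simpl; ring).
  rewrite (RInt_scal (V := R_CompleteNormedModule) (fun x => G x * Phi (yy x e)))
    by now apply ex_RInt_continuous_everywhere.
  rewrite (RInt_scal (V := R_CompleteNormedModule) (fun x => G (- x) * Phi (yy (- x) e)))
    by (apply ex_RInt_continuous_everywhere; intros t;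
        apply (Hopp (fun x => G x * Phi (yy x e))); auto).
  unfold plus, opp, scal; simpl; unfold mult; simpl. ring.
Qed.

(** * The hypothesis in the coordinate e *)

Lemma Rpower_sq_half (X : R) (n : nat) : 0 < X ->
  Rpower (X ^ 2) (INR n - 1 / 2) = X ^ (2 * n) / X.
Proof.
  intros HX. rewrite <- (Rpower_pow 2 X) by auto. rewrite Rpower_mult.
  replace (INR 2 * (INR n - 1 / 2)) with (INR (2 * n) + Ropp 1) by (rewrite mult_INR; simpl; field).
  rewrite Rpower_plus, Rpower_Ropp, Rpower_1, Rpower_pow by auto. reflexivity.
Qed.

Lemma kernel_base_pos (s t : R) : 0 < s -> 0 < t -> t < 1 - s \/ 1 + s < t ->
  0 < ((1 + t) ^ 2 - s ^ 2) * ((1 - t) ^ 2 - s ^ 2).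
Proof.
  intros Hs Ht H. apply Rmult_lt_0_compat; destruct H; nra.
Qed.

Lemma continuous_kernel_integrand (alpha : nat) (h : R -> R) (s t : R) :
  (forall t, continuous h t) -> 0 < s -> 0 < t -> t < 1 - s \/ 1 + s < t ->
  continuous (kernel_integrand alpha h s) t.
Proof.
  intros Hh Hs Ht H. unfold kernel_integrand.
  apply (continuous_mult (K := R_AbsRing)).
  - apply (continuous_mult (K := R_AbsRing)).
    + apply (continuous_mult (K := R_AbsRing)); [apply continuous_id | apply Hh].
    + apply (ex_derive_continuous (V := R_NormedModule)). auto_derive.
      apply pow_nonzero. lra.
  - assert (HP := kernel_base_pos s t Hs Ht H).
    apply (ex_derive_continuous (V := R_NormedModule)). unfold Rpower. auto_derive.
    simpl in HP |- *. unfold Rminus in HP. exact HP.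
Qed.

(** The two factors of the base are [2 t (cosh e + 1)] and [2 t (cosh e - 1)], with product
    [(2 t sinh e)^2]. The power [alpha - 1 / 2] leaves one [2 t sinh e] in the denominator, which
    the prefactor [t sinh e] cancels. *)
Lemma kernel_integrand_at (alpha : nat) (h : R -> R) (s t e : R) :
  0 < t -> 0 < sinh e -> t ^ 2 - 2 * t * cosh e + 1 = s ^ 2 ->
  t * sinh e * kernel_integrand alpha h s t
  = 4 ^ alpha / 2 * (sinh e ^ (2 * alpha) * (t * h t)).
Proof.
  intros Ht He E. unfold kernel_integrand.
  replace (((1 + t) ^ 2 - s ^ 2) * ((1 - t) ^ 2 - s ^ 2)) with ((2 * t * sinh e) ^ 2).
  2:{ rewrite <- E.
      replace ((2 * t * sinh e) ^ 2) with (4 * t ^ 2 * ((1 + sinh e ^ 2) - 1)) by ring.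
      rewrite <- cosh_sinh_sq. ring. }
  rewrite Rpower_sq_half by (apply Rmult_lt_0_compat; lra).
  rewrite !Rpow_mult_distr, (pow_mult 2). replace (2 ^ 2) with 4 by ring.
  field. repeat split; try lra. apply pow_nonzero; lra.
Qed.

(** By the intermediate value theorem all points slightly above [p] are values of [phi] on [(0, d)].
    This is the premise on the singular end in [is_RInt_gen_substitution]. *)
Lemma at_right_image (phi : R -> R) (p H d : R) :
  (forall e, continuous phi e) -> phi 0 = p -> (forall e, 0 < e <= H -> p < phi e) ->
  0 < d < H -> at_right p (fun a => exists e, 0 < e < d /\ a = phi e).
Proof.
  intros Hc H0 Hgt Hd.
  assert (Hpd : 0 < phi d - p) by (generalize (Hgt d ltac:(lra)); lra).
  exists (mkposreal _ Hpd). intros a Ha Hpa. change (Rabs (a - p) < phi d - p) in Ha.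
  rewrite Rabs_pos_eq in Ha by lra.
  destruct (IVT_gen phi 0 d a) as [e [He Ea]].
  - intros e. apply continuity_pt_filterlim, Hc.
  - rewrite H0, Rmin_left, Rmax_right by lra. lra.
  - rewrite Rmin_left, Rmax_right in He by lra. exists e.
    assert (e <> 0) by (intros ->; lra). assert (e <> d) by (intros ->; lra).
    split; [lra | auto].
Qed.

Lemma at_left_image (phi : R -> R) (p H d : R) :
  (forall e, continuous phi e) -> phi 0 = p -> (forall e, 0 < e <= H -> phi e < p) ->
  0 < d < H -> at_left p (fun a => exists e, 0 < e < d /\ a = phi e).
Proof.
  intros Hc H0 Hgt Hd.
  assert (Hpd : 0 < p - phi d) by (generalize (Hgt d ltac:(lra)); lra).
  exists (mkposreal _ Hpd). intros a Ha Hpa. change (Rabs (a - p) < p - phi d) in Ha.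
  rewrite Rabs_left1 in Ha by lra.
  destruct (IVT_gen phi 0 d a) as [e [He Ea]].
  - intros e. apply continuity_pt_filterlim, Hc.
  - rewrite H0, Rmin_right, Rmax_left by lra. lra.
  - rewrite Rmin_left, Rmax_right in He by lra. exists e.
    assert (e <> 0) by (intros ->; lra). assert (e <> d) by (intros ->; lra).
    split; [lra | auto].
Qed.

Lemma is_RInt_zero_fun (f : R -> R) (a b : R) :
  (forall x, Rmin a b < x < Rmax a b -> f x = 0) -> is_RInt f a b 0.
Proof.
  intros Hf. apply (is_RInt_ext (fun _ => 0)).
  - intros x Hx. symmetry. now apply Hf.
  - assert (E := is_RInt_const (V := R_NormedModule) a b 0).
    unfold scal in E; simpl in E; unfold mult in E; simpl in E. rewrite Rmult_0_r in E.
    exact E.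
Qed.

Lemma sinh_pos (e : R) : 0 < e -> 0 < sinh e.
Proof. intros He. rewrite <- sinh_0. now apply sinh_lt. Qed.

Lemma exp_eq_cosh_sinh (e : R) : exp e = cosh e + sinh e.
Proof. unfold cosh, sinh. lra. Qed.

(** The substitutions [t = cosh e +- rt v e] have [dt = +- t sinh e / rt de], which removes the
    singularity. Both improper integrals become proper ones over [[0, H]], and their difference is a
    constant times the [folded] integral. *)
Lemma kernel_condition_fold (alpha : nat) (h : R -> R) (c d H : R) :
  (forall t, continuous h t) -> 0 < c -> d < 2 -> (forall x, x < c \/ d < x -> h x = 0) ->
  0 < H -> 2 <= exp H -> exp (- H) <= c ->
  (forall s, 0 < s < 1 ->
     RInt_gen (kernel_integrand alpha h s) (at_right 0) (at_left (1 - s))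
     = RInt_gen (kernel_integrand alpha h s) (at_right (1 + s)) (at_left 2)) ->
  forall v, 0 < v < 1 ->
    RInt (fun e => sinh e ^ (2 * alpha) * folded (logw h 1) v e) 0 H = 0.
Proof.
  intros Hh Hc Hd Hsupp HH H2 Hcc Hint v Hv.
  set (s := sqrt v).
  assert (Hs2 : s ^ 2 = v) by (unfold s; rewrite <- Rsqr_pow2; apply Rsqr_sqrt; lra).
  assert (Hs0 : 0 < s) by (apply sqrt_lt_R0; lra).
  assert (Hs1 : s < 1) by nra.
  set (K := kernel_integrand alpha h s).
  set (tp := fun e => cosh e + rt v e). set (tm := fun e => cosh e - rt v e).
  assert (Hrt : forall e, 0 < rt v e) by (intros; apply rt_pos; lra).
  assert (Hrt2 : forall e, rt v e ^ 2 = v + sinh e ^ 2) by (intros; apply rt_sq; lra).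
  assert (Hlt : forall e, rt v e < cosh e) by (intros; now apply rt_lt_cosh).
  assert (Hrt0 : rt v 0 = s) by (unfold rt, s; rewrite sinh_0; f_equal; ring).
  assert (Hc0 : cosh 0 = 1) by (unfold cosh; rewrite Ropp_0, exp_0; lra).
  assert (Hrts : forall e, s <= rt v e).
  { intros e. apply sqrt_le_1_alt. generalize (pow2_ge_0 (sinh e)). lra. }
  assert (Hcosh : forall e, 0 < e -> 1 < cosh e).
  { intros e He. generalize (sinh_pos e He) (cosh_sinh_sq e) (cosh_ge_1 e). nra. }
  assert (Htp : forall e, 0 < e -> 1 + s < tp e).
  { intros e He. unfold tp. generalize (Hrts e) (Hcosh e He). lra. }
  assert (Hprod : forall e, tm e * tp e = 1 - v).
  { intros e. unfold tm, tp. generalize (Hrt2 e) (cosh_sinh_sq e). nra. }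
  assert (Htm0 : forall e, 0 < tm e) by (intros e; unfold tm; generalize (Hlt e); lra).
  (* From [tm e * tp e = (1 - s) (1 + s)] and [tp e > 1 + s]. *)
  assert (Htm : forall e, 0 < e -> tm e < 1 - s).
  { intros e He. generalize (Htp e He) (Htm0 e) (Hprod e). nra. }
  assert (Hrtd : forall e, is_derive (rt v) e (sinh e * cosh e / rt v e))
    by (intros; apply is_derive_rt_r; lra).
  assert (Hdtp : forall e, is_derive tp e (tp e * sinh e / rt v e)).
  { intros e. replace (tp e * sinh e / rt v e) with (sinh e + sinh e * cosh e / rt v e)
      by (unfold tp; field; generalize (Hrt e); lra).
    apply (is_derive_plus (V := R_NormedModule)); [apply is_derive_cosh | apply Hrtd]. }
  assert (Hdtm : forall e, is_derive tm e (- (tm e * sinh e / rt v e))).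
  { intros e. replace (- (tm e * sinh e / rt v e)) with (sinh e - sinh e * cosh e / rt v e)
      by (unfold tm; field; generalize (Hrt e); lra).
    apply (is_derive_minus (V := R_NormedModule)); [apply is_derive_cosh | apply Hrtd]. }
  assert (Hctp : forall e, continuous tp e).
  { intros e. apply (ex_derive_continuous (V := R_NormedModule)). eexists; apply Hdtp. }
  assert (Hctm : forall e, continuous tm e).
  { intros e. apply (ex_derive_continuous (V := R_NormedModule)). eexists; apply Hdtm. }
  assert (Hcinv : forall e, continuous (fun e => / rt v e) e).
  { intros e. apply (continuous_comp (rt v) Rinv).
    - apply (ex_derive_continuous (V := R_NormedModule)). eexists; apply Hrtd.
    - apply (ex_derive_continuous (V := R_NormedModule)). auto_derive. generalize (Hrt e). lra. }
  assert (Hcd : forall (f : R -> R), (forall e, continuous f e) ->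
    forall e, continuous (fun e => f e * sinh e / rt v e) e).
  { intros f Hf e. apply (continuous_mult (K := R_AbsRing)); auto.
    apply (continuous_mult (K := R_AbsRing)); auto. apply continuous_sinh. }
  set (k := fun (f : R -> R) e =>
              4 ^ alpha / 2 * (sinh e ^ (2 * alpha) * (f e * h (f e)) / rt v e)).
  assert (Hck : forall (f : R -> R), (forall e, continuous f e) ->
    forall e, continuous (k f) e).
  { intros f Hf e. apply (continuous_mult (K := R_AbsRing)); [apply continuous_const|].
    apply (continuous_mult (K := R_AbsRing)); auto.
    apply (continuous_mult (K := R_AbsRing)); [apply continuous_sinh_pow|].
    apply (continuous_mult (K := R_AbsRing)); auto.
    apply (continuous_comp f h); auto. }
  assert (Hquad : forall e, tp e ^ 2 - 2 * tp e * cosh e + 1 = s ^ 2 /\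
                            tm e ^ 2 - 2 * tm e * cosh e + 1 = s ^ 2).
  { intros e. rewrite Hs2. unfold tp, tm. generalize (Hrt2 e) (cosh_sinh_sq e). split; nra. }
  (* At [e = H] both branches have left the support of [h], as [tp H >= exp H] and
     [tm H <= exp (- H)]. So truncating at [H] loses nothing. *)
  assert (HtpH : 2 <= tp H).
  { generalize (sinh_le_rt v H ltac:(lra) ltac:(lra)). unfold tp.
    rewrite exp_eq_cosh_sinh in H2. lra. }
  assert (HtmH : tm H <= c).
  { generalize (sinh_le_rt v H ltac:(lra) ltac:(lra)). unfold tm.
    replace (exp (- H)) with (cosh H - sinh H) in Hcc by (unfold cosh, sinh; lra). lra. }
  assert (HK0 : forall t, t < c \/ d < t -> K t = 0).
  { intros t Ht. unfold K, kernel_integrand. rewrite Hsupp by auto.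
    unfold Rdiv. ring. }
  assert (Hplus : is_RInt_gen K (at_right (1 + s)) (at_left 2) (RInt (k tp) 0 H)).
  { apply (is_RInt_gen_substitution K tp (fun e => tp e * sinh e / rt v e) (k tp) H).
    - apply at_right_proper_filter.
    - apply at_left_proper_filter.
    - exact HH.
    - intros; apply Hdtp.
    - intros; now apply Hcd.
    - intros e He. apply continuous_kernel_integrand; auto.
      + generalize (Htp e (proj1 He)). lra.
      + right. now apply Htp.
    - intros e He. apply (ex_RInt_continuous (V := R_CompleteNormedModule)).
      intros t Ht. assert (1 + s < t).
      { apply Rlt_le_trans with (Rmin (tp e) (tp H)); [|tauto].
        apply Rmin_glb_lt; apply Htp; lra. }
      apply continuous_kernel_integrand; auto; lra.
    - intros e He. unfold k.
      replace (tp e * sinh e / rt v e * K (tp e)) with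
        (tp e * sinh e * K (tp e) / rt v e) by (field; generalize (Hrt e); lra).
      unfold K. rewrite (kernel_integrand_at alpha h s (tp e) e).
      + field. generalize (Hrt e); lra.
      + generalize (Htp e (proj1 He)). lra.
      + now apply sinh_pos.
      + apply Hquad.
    - now apply Hck.
    - intros d0 Hd0. apply (at_right_image tp (1 + s) H d0); auto.
      + unfold tp. rewrite Hc0, Hrt0. reflexivity.
      + intros e He. now apply Htp.
    - assert (Hp : 0 < 2 - d) by lra. exists (mkposreal _ Hp). intros b Hb Hb2.
      change (Rabs (b - 2) < 2 - d) in Hb. rewrite Rabs_left1 in Hb by lra.
      apply is_RInt_zero_fun. intros x Hx. apply HK0. right.
      apply Rlt_trans with (Rmin (tp H) b); [apply Rmin_glb_lt; lra | tauto]. }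
  assert (Hminus : is_RInt_gen K (at_right 0) (at_left (1 - s)) (RInt (k tm) 0 H)).
  { replace (RInt (k tm) 0 H) with (opp (RInt (fun e => - k tm e) 0 H)).
    2:{ rewrite (RInt_opp (V := R_CompleteNormedModule) (k tm))
          by (apply ex_RInt_continuous_everywhere; now apply Hck).
        unfold opp; simpl. ring. }
    (* The branch [tm] starts at the upper end [1 - s] and descends, so the singular end is the
       second bound. The bounds are exchanged to make it the first, at the price of a sign. *)
    apply (is_RInt_gen_swap (V := R_NormedModule)).
    apply (is_RInt_gen_substitution K tm (fun e => - (tm e * sinh e / rt v e))
             (fun e => - k tm e) H).
    - apply at_left_proper_filter.
    - apply at_right_proper_filter.
    - exact HH.
    - intros; apply Hdtm.
    - intros. apply (continuous_opp (V := R_NormedModule)). now apply Hcd.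
    - intros e He. apply continuous_kernel_integrand; auto.
      left. now apply Htm.
    - intros e He. apply (ex_RInt_continuous (V := R_CompleteNormedModule)).
      intros t Ht. assert (t < 1 - s).
      { apply Rle_lt_trans with (Rmax (tm e) (tm H)); [tauto|].
        apply Rmax_lub_lt; apply Htm; lra. }
      assert (0 < t).
      { apply Rlt_le_trans with (Rmin (tm e) (tm H)); [|tauto].
        apply Rmin_glb_lt; apply Htm0. }
      apply continuous_kernel_integrand; auto.
    - intros e He. unfold k.
      replace (- (tm e * sinh e / rt v e) * K (tm e)) with
        (- (tm e * sinh e * K (tm e) / rt v e)) by (field; generalize (Hrt e); lra).
      unfold K. rewrite (kernel_integrand_at alpha h s (tm e) e).
      + field. generalize (Hrt e); lra.
      + apply Htm0.
      + now apply sinh_pos.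
      + apply Hquad.
    - intros e. apply (continuous_opp (V := R_NormedModule)). now apply Hck.
    - intros d0 Hd0. apply (at_left_image tm (1 - s) H d0); auto.
      + unfold tm. rewrite Hc0, Hrt0. reflexivity.
      + intros e He. now apply Htm.
    - exists (mkposreal _ Hc). intros b Hb Hb2.
      change (Rabs (b - 0) < c) in Hb. rewrite Rabs_pos_eq in Hb by lra.
      apply is_RInt_zero_fun. intros x Hx. apply HK0. left.
      apply Rlt_le_trans with (Rmax (tm H) b); [tauto|]. apply Rmax_lub; lra. }
  specialize (Hint s ltac:(lra)). fold K in Hint.
  rewrite (is_RInt_gen_unique (V := R_CompleteNormedModule) _ _ Hplus) in Hint.
  rewrite (is_RInt_gen_unique (V := R_CompleteNormedModule) _ _ Hminus) in Hint.
  assert (E : RInt (fun e => 4 ^ alpha / 2 * (sinh e ^ (2 * alpha) * folded (logw h 1) v e)) 0 H = 0).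
  { rewrite (RInt_ext _ (fun e => minus (k tp e) (k tm e))).
    - rewrite (RInt_minus (V := R_CompleteNormedModule))
        by (apply ex_RInt_continuous_everywhere; now apply Hck).
      rewrite Hint. unfold minus, plus, opp; simpl. ring.
    - intros e _. unfold folded, logw, k.
      change (INR 1) with 1. replace (2 - 1) with 1 by ring. rewrite !Rmult_1_l.
      rewrite exp_xp, exp_xm by lra. fold (tp e) (tm e).
      unfold minus, plus, opp; simpl. unfold Rdiv. ring. }
  rewrite (RInt_scal (V := R_CompleteNormedModule)
     (fun e => sinh e ^ (2 * alpha) * folded (logw h 1) v e)) in E.
  - unfold scal in E; simpl in E; unfold mult in E; simpl in E.
    apply Rmult_integral in E. destruct E as [E | E]; auto.
    assert (4 ^ alpha <> 0) by (apply pow_nonzero; lra). lra.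
  - apply ex_RInt_continuous_everywhere. intros e.
    apply (continuous_mult (K := R_AbsRing)); [apply continuous_sinh_pow|].
    apply continuity_2d_section_r, continuity_2d_folded; auto. intros; now apply continuous_logw.
Qed.

(** * The Bessel equation in the variable x = ln t *)

Lemma continuity_2d_exp_cosh (a b x e : R) :
  continuity_2d_pt (fun x e => a * exp x ^ 2 + b * exp x * cosh e) x e.
Proof.
  apply continuity_2d_pt_plus.
  - apply (continuity_2d_fst (fun x => a * exp x ^ 2)).
    apply (ex_derive_continuous (V := R_NormedModule)). auto_derive. auto.
  - apply continuity_2d_pt_mult.
    + apply (continuity_2d_fst (fun x => b * exp x)).
      apply (ex_derive_continuous (V := R_NormedModule)). auto_derive. auto.
    + apply continuity_2d_snd, continuous_cosh.
Qed.

Lemma yy_diag (x : R) : yy x x = 0.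
Proof.
  unfold yy, cosh. assert (E : exp x * exp (- x) = 1) by (rewrite <- exp_plus, Rplus_opp_r; apply exp_0).
  nra.
Qed.

Lemma exp_cosh_diag (x : R) : 2 * exp x ^ 2 + - 2 * exp x * cosh x = exp x ^ 2 - 1.
Proof. generalize (yy_diag x). unfold yy. lra. Qed.

Lemma is_derive_yy_l (x e : R) :
  is_derive (fun x => yy x e) x (2 * exp x ^ 2 + - 2 * exp x * cosh e).
Proof. unfold yy. auto_derive; auto. ring. Qed.

Lemma is_derive_yy_r (x e : R) : is_derive (yy x) e (- 2 * exp x * sinh e).
Proof. unfold yy. auto_derive; auto. ring. Qed.

(** By the equation of [Phi], the operator [(d/dx)^2 - (d/de)^2] multiplies [Phi (yy x e)] by
    [- 4 k exp (2 x)]. Integrating by parts twice moves [(d/de)^2] onto [w], where it acts as [a^2].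
    The upper bound [e = x] is a characteristic, along which [yy] vanishes. *)
Lemma transmute_ode (a k : R) (Phi Phi' Phi'' w w' : R -> R) :
  (forall y, is_derive Phi y (Phi' y)) -> (forall y, is_derive Phi' y (Phi'' y)) ->
  (forall y, continuous Phi'' y) ->
  (forall y, y * Phi'' y + Phi' y + k * Phi y = 0) ->
  (forall e, is_derive w e (w' e)) -> (forall e, is_derive w' e (a ^ 2 * w e)) -> w' 0 = 0 ->
  exists S' : R -> R, S' 0 = Phi 0 * w 0 /\
    (forall x, is_derive (transmute Phi w) x (S' x)) /\
    (forall x, is_derive S' x ((a ^ 2 - 4 * k * exp x ^ 2) * transmute Phi w x)).
Proof.
  intros HP HP' HP'' Hode Hw Hw' Hw0.
  set (yx := fun x e => 2 * exp x ^ 2 + - 2 * exp x * cosh e).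
  set (yxx := fun x e => 4 * exp x ^ 2 + - 2 * exp x * cosh e).
  set (df := fun x e => Phi' (yy x e) * yx x e * w e).
  set (ddf := fun x e => (Phi'' (yy x e) * yx x e ^ 2 + Phi' (yy x e) * yxx x e) * w e).
  assert (HPc : forall y, continuous Phi y).
  { intros y. apply (ex_derive_continuous (V := R_NormedModule)). eexists; apply HP. }
  assert (HPc' : forall y, continuous Phi' y).
  { intros y. apply (ex_derive_continuous (V := R_NormedModule)). eexists; apply HP'. }
  assert (Hwc : forall e, continuous w e).
  { intros e. apply (ex_derive_continuous (V := R_NormedModule)). eexists; apply Hw. }
  assert (Hcomp : forall (F : R -> R), (forall y, continuous F y) ->
    forall x e, continuity_2d_pt (fun x e => F (yy x e)) x e).
  { intros F HF x e. apply continuity_2d_pt_comp1; [apply HF | apply continuity_2d_yy]. }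
  assert (Hyx : forall x e, continuity_2d_pt yx x e) by (intros; apply continuity_2d_exp_cosh).
  assert (Hyxx : forall x e, continuity_2d_pt yxx x e) by (intros; apply continuity_2d_exp_cosh).
  assert (Hw2 : forall x e, continuity_2d_pt (fun x e => w e) x e)
    by (intros; now apply continuity_2d_snd).
  assert (Hf2 : forall x e, continuity_2d_pt (fun x e => Phi (yy x e) * w e) x e).
  { intros x e. apply continuity_2d_pt_mult; auto. }
  assert (Hdf2 : forall x e, continuity_2d_pt df x e).
  { intros x e. apply continuity_2d_pt_mult; auto. apply continuity_2d_pt_mult; auto. }
  assert (Hddf2 : forall x e, continuity_2d_pt ddf x e).
  { intros x e. apply continuity_2d_pt_mult; auto.
    apply continuity_2d_pt_plus; apply continuity_2d_pt_mult; auto.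
    apply (continuity_2d_pt_comp1 (fun y => y ^ 2) yx); auto.
    apply (ex_derive_continuous (V := R_NormedModule)). auto_derive. auto. }
  assert (Hpy : forall (F F' : R -> R), (forall y, is_derive F y (F' y)) ->
    forall x e, is_derive (fun x => F (yy x e)) x (yx x e * F' (yy x e))).
  { intros F F' HF x e. apply (is_derive_comp (V := R_NormedModule) F (fun x => yy x e)).
    - apply HF.
    - apply is_derive_yy_l. }
  assert (Hpe : forall (F F' : R -> R), (forall y, is_derive F y (F' y)) ->
    forall x e, is_derive (fun e => F (yy x e)) e (- 2 * exp x * sinh e * F' (yy x e))).
  { intros F F' HF x e. apply (is_derive_comp (V := R_NormedModule) F (yy x)).
    - apply HF.
    - apply is_derive_yy_r. }
  assert (Hdf : forall x e, is_derive (fun x => Phi (yy x e) * w e) x (df x e)).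
  { intros x e. unfold df.
    replace (Phi' (yy x e) * yx x e * w e) with (yx x e * Phi' (yy x e) * w e) by ring.
    apply (is_derive_scal_l (V := R_NormedModule) (fun x => Phi (yy x e)) x _ (w e)).
    apply (Hpy Phi Phi' HP). }
  assert (Hddf : forall x e, is_derive (fun x => df x e) x (ddf x e)).
  { intros x e. unfold df, ddf.
    replace ((Phi'' (yy x e) * yx x e ^ 2 + Phi' (yy x e) * yxx x e) * w e)
      with ((yx x e * Phi'' (yy x e) * yx x e + Phi' (yy x e) * yxx x e) * w e) by ring.
    apply (is_derive_scal_l (V := R_NormedModule) (fun x => Phi' (yy x e) * yx x e) x _ (w e)).
    apply (is_derive_mult (K := R_AbsRing) (fun x => Phi' (yy x e)) (fun x => yx x e)).
    - apply (Hpy Phi' Phi'' HP').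
    - unfold yx, yxx. auto_derive; auto. ring.
    - apply Rmult_comm. }
  set (S := transmute Phi w).
  (* The first term comes from the moving upper bound, since [yy x x = 0]. *)
  set (S' := fun x => Phi 0 * w x + RInt (df x) 0 x).
  exists S'. split; [|split].
  - unfold S'. rewrite RInt_point. apply Rplus_0_r.
  - intros x.
    replace (S' x) with (RInt (df x) 0 x - Phi (yy x 0) * w 0 * 0 + Phi (yy x x) * w x * 1)
      by (unfold S'; rewrite yy_diag; ring).
    apply (is_derive_RInt_param_bounds (fun x e => Phi (yy x e) * w e) df
             (fun _ => 0) (fun x => x)); auto.
    + intros u t. now apply (continuity_2d_section_r (fun x e => Phi (yy x e) * w e)).
    + exact (is_derive_const (K := R_AbsRing) (V := R_NormedModule) 0 x).
    + exact (is_derive_id (K := R_AbsRing) x).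
  - intros x.
    replace ((a ^ 2 - 4 * k * exp x ^ 2) * S x) with
      (Phi 0 * w' x + (RInt (ddf x) 0 x - df x 0 * 0 + df x x * 1)).
    + apply (is_derive_plus (V := R_NormedModule)).
      * apply is_derive_scal, Hw.
      * apply (is_derive_RInt_param_bounds df ddf (fun _ => 0) (fun x => x)); auto.
        -- intros u t. now apply continuity_2d_section_r.
        -- exact (is_derive_const (K := R_AbsRing) (V := R_NormedModule) 0 x).
        -- exact (is_derive_id (K := R_AbsRing) x).
    + (* Integrating [(Phi (yy x e) * w' e - d/de (Phi (yy x e)) * w e)'] over [0, x] produces
         the boundary terms, since [(d/dx)^2 - (d/de)^2] maps [Phi (yy x e)] to
         [4 exp (2 x) (y Phi'' + Phi')]. *)
      set (B' := fun e => a ^ 2 * (Phi (yy x e) * w e)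
                   - (Phi'' (yy x e) * (- 2 * exp x * sinh e) ^ 2
                      + Phi' (yy x e) * (- 2 * exp x * cosh e)) * w e).
      assert (HB : is_RInt B' 0 x
        (minus (Phi (yy x x) * w' x - - 2 * exp x * sinh x * Phi' (yy x x) * w x)
               (Phi (yy x 0) * w' 0 - - 2 * exp x * sinh 0 * Phi' (yy x 0) * w 0))).
      { apply (is_RInt_derive (V := R_CompleteNormedModule)
          (fun e => Phi (yy x e) * w' e - - 2 * exp x * sinh e * Phi' (yy x e) * w e)).
        - intros e _.
          replace (B' e) with
            ((- 2 * exp x * sinh e * Phi' (yy x e) * w' e + Phi (yy x e) * (a ^ 2 * w e))
             - ((- 2 * exp x * cosh e * Phi' (yy x e)
                 + - 2 * exp x * sinh e * (- 2 * exp x * sinh e * Phi'' (yy x e))) * w e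
                + - 2 * exp x * sinh e * Phi' (yy x e) * w' e)) by (unfold B'; ring).
          apply (is_derive_minus (V := R_NormedModule)).
          + apply (is_derive_mult (K := R_AbsRing) (fun e => Phi (yy x e)) w'); [apply (Hpe Phi Phi' HP) | apply Hw' | apply Rmult_comm].
          + apply (is_derive_mult (K := R_AbsRing) (fun e => - 2 * exp x * sinh e * Phi' (yy x e)) w);
              [|apply Hw | apply Rmult_comm].
            apply (is_derive_mult (K := R_AbsRing) (fun e => - 2 * exp x * sinh e) (fun e => Phi' (yy x e)));
              [|apply (Hpe Phi' Phi'' HP') | apply Rmult_comm].
            apply is_derive_scal, is_derive_sinh.
        - intros e _. unfold B'.
          apply (continuous_minus (V := R_NormedModule)).
          + apply (continuous_scal_r (V := R_NormedModule) (a ^ 2) (fun e => Phi (yy x e) * w e)).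
            apply (continuity_2d_section_r (fun x e => Phi (yy x e) * w e)); auto.
          + apply (continuous_mult (K := R_AbsRing)); auto.
            apply (continuous_plus (V := R_NormedModule)); apply (continuous_mult (K := R_AbsRing)).
            * apply (continuity_2d_section_r (fun x e => Phi'' (yy x e))); auto.
            * apply (ex_derive_continuous (V := R_NormedModule)). auto_derive. auto.
            * apply (continuity_2d_section_r (fun x e => Phi' (yy x e))); auto.
            * apply (ex_derive_continuous (V := R_NormedModule)). auto_derive. auto. }
      assert (Hd : is_RInt (ddf x) 0 x (RInt (ddf x) 0 x)).
      { apply (RInt_correct (V := R_CompleteNormedModule)), ex_RInt_continuous_everywhere.
        intros e. now apply continuity_2d_section_r. }
      assert (Hsum := is_RInt_plus (V := R_NormedModule) _ _ _ _ _ _ Hd HB).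
      assert (HS : is_RInt (fun e => (a ^ 2 - 4 * k * exp x ^ 2) * (Phi (yy x e) * w e)) 0 x
                     ((a ^ 2 - 4 * k * exp x ^ 2) * S x)).
      { apply (is_RInt_scal (V := R_NormedModule)).
        apply (RInt_correct (V := R_CompleteNormedModule)), ex_RInt_continuous_everywhere.
        intros e. now apply (continuity_2d_section_r (fun x e => Phi (yy x e) * w e)). }
      assert (Hsum' : is_RInt (fun e => (a ^ 2 - 4 * k * exp x ^ 2) * (Phi (yy x e) * w e)) 0 x
        (plus (RInt (ddf x) 0 x)
          (minus (Phi (yy x x) * w' x - - 2 * exp x * sinh x * Phi' (yy x x) * w x)
             (Phi (yy x 0) * w' 0 - - 2 * exp x * sinh 0 * Phi' (yy x 0) * w 0)))).
      { refine (is_RInt_ext (V := R_NormedModule) _ _ _ _ _ _ Hsum). intros e _. symmetry.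
        unfold ddf, B'.
        change (((a ^ 2 - 4 * k * exp x ^ 2) * (Phi (yy x e) * w e)) =
          (Phi'' (yy x e) * yx x e ^ 2 + Phi' (yy x e) * yxx x e) * w e +
          (a ^ 2 * (Phi (yy x e) * w e)
                   - (Phi'' (yy x e) * (- 2 * exp x * sinh e) ^ 2
                      + Phi' (yy x e) * (- 2 * exp x * cosh e)) * w e)).
        assert (E1 : yx x e ^ 2 - (- 2 * exp x * sinh e) ^ 2 = 4 * exp x ^ 2 * yy x e).
        { replace ((- 2 * exp x * sinh e) ^ 2) with (4 * exp x ^ 2 * ((1 + sinh e ^ 2) - 1)) by ring.
          rewrite <- cosh_sinh_sq. unfold yx, yy. ring. }
        assert (E2 : yxx x e - - 2 * exp x * cosh e = 4 * exp x ^ 2) by (unfold yxx; ring).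
        assert (Hk : k * Phi (yy x e) = - (yy x e * Phi'' (yy x e) + Phi' (yy x e)))
          by (generalize (Hode (yy x e)); lra).
        replace ((a ^ 2 - 4 * k * exp x ^ 2) * (Phi (yy x e) * w e)) with
          (a ^ 2 * (Phi (yy x e) * w e) - 4 * exp x ^ 2 * (k * Phi (yy x e)) * w e) by ring.
        rewrite Hk.
        replace (4 * exp x ^ 2 * - (yy x e * Phi'' (yy x e) + Phi' (yy x e))) with
          (- (4 * exp x ^ 2 * yy x e * Phi'' (yy x e) + 4 * exp x ^ 2 * Phi' (yy x e))) by ring.
        rewrite <- E1, <- E2. ring. }
      (* Two values of one integral: the right-hand side of the equation for [S], and the integral
         of [ddf] plus boundary terms. What is left is to match the boundary terms with those of
         [S']. *)
      assert (E := eq_trans (eq_sym (is_RInt_unique (V := R_CompleteNormedModule) _ _ _ _ HS))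
                     (is_RInt_unique (V := R_CompleteNormedModule) _ _ _ _ Hsum')).
      etransitivity; [|symmetry; exact E].
      unfold plus, minus, opp; simpl. unfold plus, opp; simpl.
      unfold df, yx. rewrite exp_cosh_diag, yy_diag, Hw0, sinh_0.
      assert (E' : 2 * exp x * sinh x = exp x ^ 2 - 1).
      { unfold sinh. assert (E'' : exp x * exp (- x) = 1)
          by (rewrite <- exp_plus, Rplus_opp_r; apply exp_0). nra. }
      replace (- 2 * exp x * sinh x) with (- (exp x ^ 2 - 1)) by (rewrite <- E'; ring).
      ring.
Qed.

(** Energy estimate: with [|q| <= M] on [[0, x]], the derivative of [u^2 + u'^2] is at most
    [(1 + M) (u^2 + u'^2)]. So the energy times [exp (- (1 + M) t)] does not increase from its
    initial value [0]. *)
Lemma linear_ode_unique_right (q u u' : R -> R) (x : R) :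
  (forall x, continuous q x) -> (forall x, is_derive u x (u' x)) ->
  (forall x, is_derive u' x (q x * u x)) -> u 0 = 0 -> u' 0 = 0 -> 0 <= x -> u x = 0.
Proof.
  intros Hq Hu Hu' H0 H0' Hx.
  destruct (bounded_continuous q 0 x Hq) as [M [HM0 HM]].
  set (E := fun t => (u t ^ 2 + u' t ^ 2) * exp (- (1 + M) * t)).
  set (dE := fun t => (2 * u t * u' t + 2 * u' t * (q t * u t)
                       - (1 + M) * (u t ^ 2 + u' t ^ 2)) * exp (- (1 + M) * t)).
  assert (HE : forall t, is_derive E t (dE t)).
  { intros t. unfold E, dE.
    replace ((2 * u t * u' t + 2 * u' t * (q t * u t) - (1 + M) * (u t ^ 2 + u' t ^ 2))
             * exp (- (1 + M) * t)) with
      ((INR 2 * u' t * u t ^ 1 + INR 2 * (q t * u t) * u' t ^ 1) * exp (- (1 + M) * t)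
       + (u t ^ 2 + u' t ^ 2) * (- (1 + M) * exp (- (1 + M) * t))) by (simpl; ring).
    apply (is_derive_mult (K := R_AbsRing) (fun t => u t ^ 2 + u' t ^ 2)
             (fun t => exp (- (1 + M) * t))).
    - apply (is_derive_plus (V := R_NormedModule)); apply is_derive_pow; auto.
    - auto_derive; auto. ring.
    - apply Rmult_comm. }
  destruct (MVT_gen E 0 x dE) as [c [Hc Ec]].
  - auto.
  - intros t _. apply continuity_pt_filterlim, (ex_derive_continuous (V := R_NormedModule)).
    eexists; apply HE.
  - rewrite Rmin_left, Rmax_right in Hc by lra.
    assert (HdE : dE c <= 0).
    { unfold dE.
      assert (Hqc : - M <= q c <= M) by (apply Rabs_le_between, HM; lra).
      assert (2 * u c * u' c + 2 * u' c * (q c * u c) - (1 + M) * (u c ^ 2 + u' c ^ 2) <= 0).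
      { assert (A1 : 2 * (u c * u' c) <= u c ^ 2 + u' c ^ 2)
          by (generalize (pow2_ge_0 (u c - u' c)); lra).
        assert (A2 : - (2 * (u c * u' c)) <= u c ^ 2 + u' c ^ 2)
          by (generalize (pow2_ge_0 (u c + u' c)); lra).
        assert (A3 : q c * (2 * (u c * u' c)) <= M * (u c ^ 2 + u' c ^ 2)).
        { set (p := 2 * (u c * u' c)) in *. set (r := u c ^ 2 + u' c ^ 2) in *.
          destruct (Rle_dec 0 p); [apply Rle_trans with (M * p) | apply Rle_trans with (M * - p)]; nra. }
        lra. }
      generalize (exp_pos (- (1 + M) * c)). nra. }
    assert (E0 : E 0 = 0) by (unfold E; rewrite H0, H0'; ring).
    assert (Ex : E x <= 0) by nra.
    unfold E in Ex. generalize (exp_pos (- (1 + M) * x)) (pow2_ge_0 (u x)) (pow2_ge_0 (u' x)). intros.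
    assert (u x ^ 2 <= 0) by nra. nra.
Qed.

(** The equation has no first-order term, so reflection in [0] preserves its form and covers
    negative [x]. *)
Lemma linear_ode_unique (q u u' : R -> R) (x : R) :
  (forall x, continuous q x) -> (forall x, is_derive u x (u' x)) ->
  (forall x, is_derive u' x (q x * u x)) -> u 0 = 0 -> u' 0 = 0 -> u x = 0.
Proof.
  intros Hq Hu Hu' H0 H0'.
  destruct (Rle_dec 0 x) as [Hx | Hx]; [now apply (linear_ode_unique_right q u u')|].
  rewrite <- (Ropp_involutive x).
  assert (Hneg : forall t : R, is_derive Ropp t (- 1)) by (intros t; auto_derive; auto).
  apply (linear_ode_unique_right (fun t => q (- t)) (fun t => u (- t)) (fun t => - u' (- t))).
  - intros t. apply (continuous_comp Ropp q); auto.
    apply (continuous_opp (V := R_NormedModule) (fun t => t)), continuous_id.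
  - intros t. replace (- u' (- t)) with (-1 * u' (- t)) by ring.
    apply (is_derive_comp (V := R_NormedModule) u Ropp); auto.
  - intros t. replace (q (- t) * u (- t)) with (- (- 1 * (q (- t) * u (- t)))) by ring.
    apply (is_derive_opp (V := R_NormedModule)).
    apply (is_derive_comp (V := R_NormedModule) u' Ropp); auto.
  - now rewrite Ropp_0.
  - rewrite Ropp_0, H0'. ring.
  - lra.
Qed.

(** For [k = (lambda / 2)^2] and [V] equal to [besselA n] or [besselU n], this is a constant times
    [J_n] or [Y_n] at [lambda exp x]. In the variable [x] Bessel's equation for it has no
    first-order term. *)
Definition log_form (n : nat) (k : R) (V : R -> R) (x : R) : R :=
  exp (INR n * x) * V (k * exp x ^ 2).

Lemma log_form_ode (n : nat) (k : R) (V V' V'' : R -> R) :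
  0 < k -> bessel_sol n V V' V'' ->
  exists U' : R -> R,
    (forall x, is_derive (log_form n k V) x (U' x)) /\
    (forall x, is_derive U' x ((INR n ^ 2 - 4 * k * exp x ^ 2) * log_form n k V x)).
Proof.
  intros Hk HV.
  set (z := fun x => k * exp x ^ 2).
  assert (Hz : forall x, 0 < z x).
  { intros x. apply Rmult_lt_0_compat; auto. apply pow_lt, exp_pos. }
  assert (Hdz : forall x, is_derive z x (2 * z x)) by (intros x; unfold z; auto_derive; auto; ring).
  assert (Hexp : forall x, is_derive (fun x => exp (INR n * x)) x (INR n * exp (INR n * x))).
  { intros x. auto_derive; auto. ring. }
  assert (HdV : forall x, is_derive (fun x => V (z x)) x (2 * z x * V' (z x))).
  { intros x. apply (is_derive_comp (V := R_NormedModule) V z); auto. now apply HV. }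
  assert (HdV' : forall x, is_derive (fun x => V' (z x)) x (2 * z x * V'' (z x))).
  { intros x. apply (is_derive_comp (V := R_NormedModule) V' z); auto. now apply HV. }
  exists (fun x => INR n * exp (INR n * x) * V (z x) + exp (INR n * x) * (2 * z x * V' (z x))).
  split; intros x.
  - apply (is_derive_mult (K := R_AbsRing) (fun x => exp (INR n * x)) (fun x => V (z x))); auto.
    apply Rmult_comm.
  - replace ((INR n ^ 2 - 4 * k * exp x ^ 2) * log_form n k V x) with
      ((INR n * (INR n * exp (INR n * x)) * V (z x)
        + INR n * exp (INR n * x) * (2 * z x * V' (z x)))
       + (INR n * exp (INR n * x) * (2 * z x * V' (z x))
          + exp (INR n * x) * (2 * (2 * z x) * V' (z x) + 2 * z x * (2 * z x * V'' (z x))))).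
    + apply (is_derive_plus (V := R_NormedModule)).
      * apply (is_derive_mult (K := R_AbsRing) (fun x => INR n * exp (INR n * x)) (fun x => V (z x)));
          auto; [|apply Rmult_comm]. now apply is_derive_scal.
      * apply (is_derive_mult (K := R_AbsRing) (fun x => exp (INR n * x))
                 (fun x => 2 * z x * V' (z x))); auto; [|apply Rmult_comm].
        apply (is_derive_mult (K := R_AbsRing) (fun x => 2 * z x) (fun x => V' (z x)));
          auto; [|apply Rmult_comm]. now apply is_derive_scal.
    + destruct (HV (z x) (Hz x)) as [_ [_ Ho]]. unfold log_form.
      replace (4 * k * exp x ^ 2) with (4 * z x) by (unfold z; ring). fold (z x).
      replace (V (z x)) with (- (z x * V'' (z x) + (INR n + 1) * V' (z x))) by lra. ring_simplify.
      ring.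
Qed.

Lemma continuous_log_form (n : nat) (k : R) (V V' V'' : R -> R) (x : R) :
  0 < k -> bessel_sol n V V' V'' -> continuous (log_form n k V) x.
Proof.
  intros Hk HV. destruct (log_form_ode n k V V' V'' Hk HV) as [U' [HU _]].
  apply (ex_derive_continuous (V := R_NormedModule)). eexists; apply HU.
Qed.

(** * Conclusion *)

(** [M] may be singular at [0], as [nbesselY] is. Since [h] vanishes below [c > exp (- H)], only a
    compact part of [(0, infinity)] contributes. *)
Lemma RInt_exp_substitution (h M : R -> R) (c d H : R) :
  (forall t, continuous h t) -> (forall x, x < c \/ d < x -> h x = 0) ->
  d < 2 -> 0 < H -> 2 <= exp H -> exp (- H) < c -> (forall t, 0 < t -> continuous M t) ->
  RInt (fun t => t * h t * M t) 0 2
  = RInt (fun x => exp (2 * x) * h (exp x) * M (exp x)) (- H) H.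
Proof.
  intros Hh Hs Hd HH H2 Hc HM.
  set (F := fun t => t * h t * M t).
  assert (HF0 : forall t, t < c \/ d < t -> F t = 0).
  { intros t Ht. unfold F. rewrite Hs by auto. ring. }
  assert (HF : forall t, 0 < t -> continuous F t).
  { intros t Ht. apply (continuous_mult (K := R_AbsRing)); auto.
    apply (continuous_mult (K := R_AbsRing)); auto. apply continuous_id. }
  generalize (exp_pos (- H)). intros He.
  assert (Hle : exp (- H) <= exp H) by (left; apply exp_increasing; lra).
  assert (I1 : is_RInt F 0 (exp (- H)) 0).
  { apply is_RInt_zero_fun. intros x Hx. rewrite Rmin_left, Rmax_right in Hx by lra.
    apply HF0. left; lra. }
  (* As [exp H >= 2], this piece runs backwards, over a range beyond [d]. *)
  assert (I3 : is_RInt F (exp H) 2 0).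
  { apply is_RInt_zero_fun. intros x Hx. rewrite Rmin_right, Rmax_left in Hx by lra.
    apply HF0. right; lra. }
  assert (I2 : is_RInt F (exp (- H)) (exp H)
                 (RInt (fun x => exp (2 * x) * h (exp x) * M (exp x)) (- H) H)).
  { replace (RInt (fun x => exp (2 * x) * h (exp x) * M (exp x)) (- H) H)
      with (RInt F (exp (- H)) (exp H)).
    - apply (RInt_correct (V := R_CompleteNormedModule)),
        (ex_RInt_continuous (V := R_CompleteNormedModule)).
      intros t Ht. rewrite Rmin_left in Ht by lra. apply HF. lra.
    - rewrite <- (RInt_comp (V := R_CompleteNormedModule) F exp exp).
      + apply RInt_ext. intros x _. unfold scal; simpl; unfold mult; simpl. unfold F.
        replace (2 * x) with (x + x) by ring. rewrite exp_plus. ring.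
      + intros x _. apply HF, exp_pos.
      + intros x _. split; [auto_derive; auto; ring|].
        apply (ex_derive_continuous (V := R_NormedModule)). auto_derive. auto. }
  assert (I := is_RInt_Chasles (V := R_NormedModule) _ _ _ _ _ _
     (is_RInt_Chasles (V := R_NormedModule) _ _ _ _ _ _ I1 I2) I3).
  etransitivity; [apply (is_RInt_unique (V := R_CompleteNormedModule) _ _ _ _ I)|].
  unfold plus; simpl. ring.
Qed.

Theorem theorem2p3 (alpha : nat) (h : R -> R)
  (hh : Cc_infty 0 2 h)
  (hint : forall s : R, 0 < s < 1 ->
     RInt_gen (kernel_integrand alpha h s) (at_right 0) (at_left (1 - s))
     = RInt_gen (kernel_integrand alpha h s) (at_right (1 + s)) (at_left 2))
  (lambda : R) (hlambda : 0 < lambda) :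
  nbesselY alpha lambda * RInt (fun t => t * h t * nbesselJ alpha (lambda * t)) 0 2
  = nbesselJ alpha lambda * RInt (fun t => t * h t * nbesselY alpha (lambda * t)) 0 2.
Proof.
  destruct hh as [Hsm [c [d [Hc [Hd Hs]]]]].
  assert (Hh : forall t, continuous h t).
  { intros t. apply (ex_derive_continuous (V := R_NormedModule)). exact (Hsm 1%nat t). }
  (* From [exp H > 1 + H = 2 + / c] follow both [2 <= exp H] and [exp (- H) < c], so [[- H, H]]
     contains the support of [h] in the variable [ln t]. *)
  set (H := 1 + / c).
  assert (Hic : 0 < / c) by now apply Rinv_0_lt_compat.
  assert (HH : 0 < H) by (unfold H; lra).
  assert (HeH : 1 + H < exp H) by (apply exp_ineq1; lra).
  assert (H2 : 2 <= exp H) by (unfold H in *; lra).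
  assert (HmH : exp (- H) < c).
  { rewrite exp_Ropp, <- (Rinv_inv c). apply Rinv_lt_contravar; [|unfold H in *; lra].
    apply Rmult_lt_0_compat; [auto | apply exp_pos]. }
  assert (Hs1 : forall x, H <= x \/ x <= - H -> h (exp x) = 0).
  { intros x [Hx | Hx]; apply Hs.
    - right. assert (exp H <= exp x)
        by (destruct Hx as [Hx | <-]; [left; now apply exp_increasing | lra]). lra.
    - left. assert (exp x <= exp (- H))
        by (destruct Hx as [Hx | ->]; [left; now apply exp_increasing | lra]). lra. }
  set (k := (lambda / 2) ^ 2).
  assert (Hk : 0 < k) by (apply pow_lt; lra).
  (* With [t = exp x], [G] times the factor [t^alpha] of [log_form] is [t^2 h(t)], which is [t h(t)]
     together with [dt = t dx]. *)
  set (G := logw h alpha).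
  assert (HG : forall x, continuous G x) by (intros; now apply continuous_logw).
  set (q := gegen (INR alpha) alpha).
  set (w := fun e => fst q (cosh e)).
  assert (Hwc : forall e, continuous w e) by (intros; apply continuous_gegen_cosh).
  set (w' := fun e => sinh e * snd q (cosh e)).
  assert (Hw : forall e, is_derive w e (w' e)).
  { intros e. apply (is_derive_comp (V := R_NormedModule) (fst q) cosh).
    - exact (proj1 (is_derive_gegen (INR alpha) alpha (cosh e))).
    - apply is_derive_cosh. }
  assert (Hw' : forall e, is_derive w' e (INR alpha ^ 2 * w e)).
  { intros e. assert (Ho := gegen_ode (INR alpha) alpha (cosh e)). fold q in Ho.
    rewrite cosh_sinh_sq in Ho.
    replace (INR alpha ^ 2 * w e) with
      (cosh e * snd q (cosh e) + sinh e * (sinh e * gegen'' (INR alpha) alpha (cosh e)))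
      by (unfold w; lra).
    apply (is_derive_mult (K := R_AbsRing) sinh (fun e => snd q (cosh e)));
      [apply is_derive_sinh | | apply Rmult_comm].
    apply (is_derive_comp (V := R_NormedModule) (snd q) cosh).
    - exact (proj2 (is_derive_gegen (INR alpha) alpha (cosh e))).
    - apply is_derive_cosh. }
  assert (Hw0 : w 0 <> 0).
  { unfold w. rewrite cosh_0. apply gegen_one. auto. }
  (* For [y > 0] this is [J_0(lambda sqrt y)]; in this form it is smooth on all of [R], in
     particular across [y = 0]. *)
  set (Phi := fun y => besselA 0 (k * y)).
  assert (Hlin : forall (f f' : R -> R), (forall y, is_derive f y (f' y)) ->
    forall y, is_derive (fun y => f (k * y)) y (k * f' (k * y))).
  { intros f f' Hf y. apply (is_derive_comp (V := R_NormedModule) f (fun y => k * y)); auto.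
    auto_derive; auto. ring. }
  set (Phi' := fun y => k * besselA' 0 (k * y)).
  set (Phi'' := fun y => k * (k * besselA'' 0 (k * y))).
  assert (HP : forall y, is_derive Phi y (Phi' y)).
  { apply Hlin, is_derive_besselA. }
  assert (HP' : forall y, is_derive Phi' y (Phi'' y)).
  { intros y. apply is_derive_scal. apply (Hlin _ _ (is_derive_besselA' 0)). }
  assert (HPc : forall y, continuous Phi y).
  { intros y. apply (ex_derive_continuous (V := R_NormedModule)). eexists; apply HP. }
  assert (HP'' : forall y, continuous Phi'' y).
  { intros y. apply (continuous_scal_r (V := R_NormedModule) k (fun y => k * besselA'' 0 (k * y))).
    apply (continuous_scal_r (V := R_NormedModule) k (fun y => besselA'' 0 (k * y))).
    apply (continuous_comp (fun y => k * y) (besselA'' 0)).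
    - apply (ex_derive_continuous (V := R_NormedModule)). auto_derive. auto.
    - apply continuous_besselA''. }
  destruct (transmute_ode (INR alpha) k Phi Phi' Phi'' w w' HP HP' HP'') as [S' [HS0 [HS HS']]]; auto.
  { intros y. generalize (besselA_ode 0 (k * y)). unfold Phi, Phi', Phi''. simpl (INR 0). nra. }
  { unfold w'. rewrite sinh_0. ring. }
  set (S := transmute Phi w) in *.
  assert (HPhi0 : Phi 0 = 1).
  { unfold Phi. rewrite Rmult_0_r, besselA_0. simpl. field. }
  assert (Horth : RInt (fun x => G x * S x) (- H) H = 0).
  { unfold S. rewrite RInt_transmute; auto.
    2:{ intros e. unfold w. now rewrite cosh_opp. }
    (* The midpoint of [d] and [2] lies strictly beyond the support of [h] and strictly below [2];
       the maximum with [1] keeps the argument of [ln] positive when [d] is small. *)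
    set (b := ln (Rmax 1 ((d + 2) / 2))).
    assert (Hm : 1 <= Rmax 1 ((d + 2) / 2) < 2) by (split; [apply Rmax_l | apply Rmax_lub_lt; lra]).
    assert (Hb : exp b = Rmax 1 ((d + 2) / 2)) by (apply exp_ln; lra).
    assert (Hb2 : b < ln 2) by (apply ln_increasing; lra).
    apply (outer0_integral_zero H b); auto.
    - rewrite <- (ln_exp H). apply Rlt_le, Rlt_le_trans with (1 := Hb2). apply ln_le; lra.
    - intros x Hx. unfold G, logw. destruct Hx as [Hx | Hx].
      + rewrite Hs; [ring|]. right.
        assert (exp b <= exp x)
          by (destruct Hx as [Hx | <-]; [left; now apply exp_increasing | lra]).
        generalize (Rmax_r 1 ((d + 2) / 2)). lra.
      + rewrite Hs1 by auto. ring.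
    - intros v Hv.
      etransitivity; [|apply (gegen_fold_integral alpha h H) with (m := alpha) (v := v); auto].
      + apply RInt_ext. intros e _. real_eq.
        rewrite Nat.sub_diag. unfold w, q. simpl pow. rewrite Rmult_1_l. f_equal.
        apply folded_ext. intros x. apply logw_succ.
      + lra.
      + apply (kernel_condition_fold alpha h c d H); auto. lra. }
  set (u1 := log_form alpha k (besselA alpha)). set (u2 := log_form alpha k (besselU alpha)).
  assert (Hcu1 : forall x, continuous u1 x)
    by (intros; exact (continuous_log_form _ _ _ _ _ _ Hk (bessel_sol_A alpha))).
  assert (Hcu2 : forall x, continuous u2 x)
    by (intros; exact (continuous_log_form _ _ _ _ _ _ Hk (bessel_sol_U alpha))).
  destruct (log_form_ode alpha k _ _ _ Hk (bessel_sol_A alpha)) as [u1' [Hu1 Hu1']].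
  destruct (log_form_ode alpha k _ _ _ Hk (bessel_sol_U alpha)) as [u2' [Hu2 Hu2']].
  fold u1 in Hu1, Hu1'. fold u2 in Hu2, Hu2'.
  set (A := besselA alpha k). set (U := besselU alpha k).
  (* At [x = 0] both [U * u1 - A * u2] and [S] vanish, so a multiple of [S] is fixed by the
     derivatives there; [S' 0 = w 0] because [Phi 0 = 1]. *)
  set (r := (U * u1' 0 - A * u2' 0) / w 0).
  set (Q := fun x => INR alpha ^ 2 - 4 * k * exp x ^ 2).
  assert (Hprop : forall x, U * u1 x - A * u2 x = r * S x).
  { intros x. apply Rminus_diag_uniq.
    apply (linear_ode_unique Q (fun x => U * u1 x - A * u2 x - r * S x)
             (fun x => U * u1' x - A * u2' x - r * S' x)).
    - intros t. apply (ex_derive_continuous (V := R_NormedModule)). unfold Q. auto_derive. auto.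
    - intros t. repeat apply (is_derive_minus (V := R_NormedModule)); now apply is_derive_scal.
    - intros t.
      replace (Q t * (U * u1 t - A * u2 t - r * S t)) with
        (U * (Q t * u1 t) - A * (Q t * u2 t) - r * (Q t * S t)) by ring.
      repeat apply (is_derive_minus (V := R_NormedModule)); now apply is_derive_scal.
    - unfold u1, u2, log_form, S, transmute. rewrite RInt_point.
      rewrite !Rmult_0_r, exp_0, !Rmult_1_l.
      replace (k * 1 ^ 2) with k by ring. fold A U.
      unfold zero; simpl. ring.
    - rewrite HS0, HPhi0. unfold r. field. exact Hw0. }
  assert (HGu : forall u, (forall x, continuous u x) ->
                  forall x, continuous (fun x => G x * u x) x).
  { intros u Hu x. now apply (continuous_mult (K := R_AbsRing)). }
  assert (HcS : forall x, continuous S x) by (intros; now apply continuous_transmute).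
  assert (Hfin : U * RInt (fun x => G x * u1 x) (- H) H = A * RInt (fun x => G x * u2 x) (- H) H).
  { assert (E : RInt (fun x => minus (scal U (G x * u1 x)) (scal A (G x * u2 x))) (- H) H
                = RInt (fun x => scal r (G x * S x)) (- H) H).
    { apply RInt_ext. intros x _.
      change (U * (G x * u1 x) - A * (G x * u2 x) = r * (G x * S x)).
      generalize (Hprop x). intros E.
      replace (r * (G x * S x)) with (G x * (r * S x)) by ring. rewrite <- E. ring. }
    rewrite (RInt_minus (V := R_CompleteNormedModule)) in E.
    2:{ apply (ex_RInt_scal (V := R_NormedModule)), ex_RInt_continuous_everywhere; auto. }
    2:{ apply (ex_RInt_scal (V := R_NormedModule)), ex_RInt_continuous_everywhere; auto. }
    rewrite !(RInt_scal (V := R_CompleteNormedModule)) in E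
      by (apply ex_RInt_continuous_everywhere; auto).
    rewrite Horth in E.
    change (U * RInt (fun x => G x * u1 x) (- H) H - A * RInt (fun x => G x * u2 x) (- H) H
            = r * 0) in E. lra. }
  (* One conversion for both kinds: [C] is [alpha!] for [nbesselJ] and [alpha! / PI] for [nbesselY],
     and the same constants multiply [A] and [U] in the values at [lambda]. *)
  assert (Hconv : forall (m : R -> R) (C : R) (V V' V'' : R -> R), bessel_sol alpha V V' V'' ->
    (forall x, 0 < x -> m x = C * V ((x / 2) ^ 2)) ->
    RInt (fun t => t * h t * m (lambda * t)) 0 2
    = C * RInt (fun x => G x * log_form alpha k V x) (- H) H).
  { intros m C V V' V'' HV Hm.
    assert (Hz : forall t, (lambda * t / 2) ^ 2 = k * t ^ 2) by (intros; unfold k; field).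
    rewrite (RInt_ext _ (fun t => t * h t * (C * V (k * t ^ 2)))).
    2:{ intros t Ht. rewrite Rmin_left in Ht by lra. rewrite Hm, Hz; auto.
        apply Rmult_lt_0_compat; lra. }
    rewrite (RInt_exp_substitution h (fun t => C * V (k * t ^ 2)) c d H); auto.
    - rewrite <- (RInt_scal (V := R_CompleteNormedModule) (fun x => G x * log_form alpha k V x)).
      + apply RInt_ext. intros x _.
        change (exp (2 * x) * h (exp x) * (C * V (k * exp x ^ 2)) = C * (G x * log_form alpha k V x)).
        unfold G, logw, log_form.
        replace (2 * x) with ((2 - INR alpha) * x + INR alpha * x) by ring.
        rewrite exp_plus. ring.
      + apply ex_RInt_continuous_everywhere, HGu. intros x.
        exact (continuous_log_form _ _ _ _ _ _ Hk HV).
    - intros t Ht. apply (continuous_scal_r (V := R_NormedModule) C (fun t => V (k * t ^ 2))).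
      apply (continuous_comp (fun t => k * t ^ 2) V).
      + apply (ex_derive_continuous (V := R_NormedModule)). auto_derive. auto.
      + apply (ex_derive_continuous (V := R_NormedModule)). exists (V' (k * t ^ 2)).
        apply HV, Rmult_lt_0_compat; auto. now apply pow_lt. }
  rewrite (Hconv (nbesselJ alpha) _ _ _ _ (bessel_sol_A alpha) (nbesselJ_eq alpha)).
  rewrite (Hconv (nbesselY alpha) _ _ _ _ (bessel_sol_U alpha) (nbesselY_eq alpha)).
  rewrite nbesselJ_eq, nbesselY_eq by auto. fold k u1 u2 A U.
  replace (INR (fact alpha) / PI * U * (INR (fact alpha) * RInt (fun x => G x * u1 x) (- H) H))
    with (INR (fact alpha) / PI * INR (fact alpha) * (U * RInt (fun x => G x * u1 x) (- H) H)) by ring.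
  rewrite Hfin. ring.
Qed.
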